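(* Let $m,n\ge1$ be integers and $\Omega_{m+1,n}=\{k=(k_1,\dots,k_{m+1})\in\mathbb{N}^{m+1}\mid k_1+\dots+k_{m+1}=n\}$, a set with $\binom{m+n}{m}$ elements. Regard $\Phi_m:\mathbb{T}^m\times\mathbb{P}_m(\tfrac1n)\to\mathbb{P}_m(\tfrac1n)$ as the regular torification of the family $\mathcal{M}(m+1,n)$ of multinomial distributions on $\Omega_{m+1,n}$, and $\mathbb{P}_{\binom{m+n}{m}-1}(1)$ with the action $\Phi_{\binom{m+n}{m}-1}$ as the regular torification of the family $\mathcal{P}^\times_{\binom{m+n}{m}}$ of all strictly positive probability functions on $\Omega_{m+1,n}$. Then the $n$-th Veronese embedding $$\mathbb{P}_m(\tfrac1n)\to\mathbb{P}_{\binom{m+n}{m}-1}(1),\qquad[z_1,\dots,z_{m+1}]\mapsto\left[\sqrt{\frac{n!}{k_1!\cdots k_{m+1}!}}\;z_1^{k_1}\cdots z_{m+1}^{k_{m+1}}\right]_{k\in\Omega_{m+1,n}}$$ is a lift of the inclusion map $\mathcal{M}(m+1,n)\hookrightarrow\mathcal{P}^\times_{\binom{m+n}{m}}$.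
   Context: Dually flat spaces. A linear connection is flat if its torsion and curvature both vanish. If $(M,h)$ is a Riemannian manifold with a linear connection $\nabla$, the dual connection $\nabla^*$ is the unique linear connection with $Xh(Y,Z)=h(\nabla_XY,Z)+h(Y,\nabla^*_XZ)$ for all vector fields $X,Y,Z$. The triple $(M,h,\nabla)$ is a dually flat space if $\nabla$ and $\nabla^*$ are both flat. Kähler structure on $TM$ (Dombrowski). Let $(M,h,\nabla)$ be dually flat, $\pi:TM\to M$ the projection, and $K:TTM\to TM$ the connector of $\nabla$ (the map, linear on each $T_u(TM)$, with $K(Y_*X)=\nabla_XY$ for all vector fields). For $u\in T_pM$ the map $A\mapsto(\pi_*A,KA)$ identifies $T_u(TM)$ with $T_pM\oplus T_pM$; under it set $g_u((v,w),(v',w'))=h_p(v,v')+h_p(w,w')$, $J_u(v,w)=(-w,v)$, $\omega_u((v,w),(v',w'))=h_p(v,w')-h_p(w,v')$. This makes $TM$ a Kähler manifold, and $TM$ always carries this structure. Parallel lattices. Let $(M,h,\nabla)$ be connected, $\dim M=n$. A parallel lattice is a subset $L\subset TM$ of the form $L=\{\sum_i k_iX_i(p)\mid p\in M,\ k_i\in\mathbb{Z}\}$ where $X=(X_1,\dots,X_n)$ are $\nabla$-parallel vector fields forming a basis of $T_pM$ at every $p$; $X$ is called a generator of $L$. $\Gamma(L)$ is the group of maps $TM\to TM$, $u\mapsto u+\sum_ik_iX_i$ ($k\in\mathbb{Z}^n$); it does not depend on the generator, acts freely and properly by holomorphic isometries, and $M_L=TM/\Gamma(L)$ carries the quotient Kähler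 structure, with quotient map $q_L:TM\to M_L$. Put $\mathbb{T}^n=\mathbb{R}^n/\mathbb{Z}^n$; for a generator $X$ let $\Phi_X([t],q_L(u))=q_L(u+\sum_it_iX_i)$, an action of $\mathbb{T}^n$ on $M_L$. Torifications and lifts. Let $N$ be a connected Kähler manifold of real dimension $2n$ with an effective holomorphic isometric action $\Phi:\mathbb{T}^n\times N\to N$; write $\Phi_a=\Phi(a,\cdot)$ and let $N^\circ$ be the set of points where $\Phi$ is free. $N$ (or $\Phi$) is a torification of the connected $n$-dimensional dually flat space $(M,h,\nabla)$ if there is a toric parametrization, i.e. a triple $(L,X,F)$ where $L$ is a parallel lattice generated by $X$ and $F:M_L\to N^\circ$ is a holomorphic isometric diffeomorphism with $F\circ(\Phi_X)_a=\Phi_a\circ F$ for all $a\in\mathbb{T}^n$. A compatible covering map is a map $\tau:TM\to N^\circ$ of the form $\tau=F\circ q_L$ for some toric parametrization $(L,X,F)$. A torification is regular if $N$ is connected, simply connected, complete with real analytic Kähler metric. A smooth map $m:N\to N'$ is a lift of a smooth map $f:M\to M'$ if there are compatible covering maps $\tau:TM\to N^\circ$ and $\tau':TM'\to(N')^\circ$ such that $m\circ\tau=\tau'\circ f_*$. Families of distributions. Both families are dually flat with the Fisher metric (components $\mathbb{E}_{p_\theta}(\partial_i\ln p_\theta\cdot\partial_j\ln p_\theta)$, equal to the Hessian of $\psi$ in the natural parameters $\theta$) and the exponential connection (the flat connection for which the natural parameters are affine coordinates). $\mathcal{M}(m+1,n)$: $p(k)=\frac{n!}{k_1!\cdots k_{m+1}!}\pi_1^{k_1}\cdots\pi_{m+1}^{k_{m+1}}$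 on $\Omega_{m+1,n}$, where $\pi_i>0$, $\sum_i\pi_i=1$; natural parameters $\theta_i=\ln(\pi_i/\pi_{m+1})$, $i=1,\dots,m$, $\psi=n\ln(1+\sum_{i=1}^me^{\theta_i})$. For a finite ordered set $\{x_1,\dots,x_{N}\}$, $\mathcal{P}_N^\times$ is the set of all $p>0$ with $\sum p=1$; natural parameters $\theta\in\mathbb{R}^{N-1}$: $p(x_i)=e^{\theta_i-\psi}$ ($i<N$), $p(x_N)=e^{-\psi}$, $\psi=\ln(1+\sum_{i<N}e^{\theta_i})$. Here the set is $\Omega_{m+1,n}$ with an arbitrary fixed ordering, which also indexes the homogeneous coordinates of $\mathbb{P}_{\binom{m+n}{m}-1}(1)$. $\mathbb{P}_n(c)$ is complex projective space of complex dimension $n$ with the Fubini–Study metric of holomorphic sectional curvature $c>0$, and $\Phi_n([t],[z])=[e^{2i\pi t_1}z_1,\dots,e^{2i\pi t_n}z_n,z_{n+1}]$. These actions are regular torifications of the families as indicated in the claim. *)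

(* Defs.v *)
From HB Require Import structures.
From mathcomp Require Import all_boot all_order all_algebra.
From mathcomp Require Import complex ring.
From mathcomp Require Import all_classical all_reals all_analysis.

Set Implicit Arguments.
Unset Strict Implicit.
Unset Printing Implicit Defensive.

Import Order.TTheory GRing.Theory Num.Theory.
Import numFieldNormedType.Exports.
Local Open Scope classical_set_scope.
Local Open Scope ring_scope.

(* C^k on the open set U, by iterated partial derivatives. *)
Fixpoint Ck (R : realType) (d : nat) (W : normedModType R) (k : nat)
    (U : set 'rV[R]_d) (f : 'rV[R]_d -> W) : Prop :=
  (forall x, U x -> {for x, continuous f}) /\
  match k with
  | 0 => True
  | k'.+1 => forall i : 'I_d,
      (forall x, U x -> derivable f x (delta_mx 0 i)) /\
      Ck k' U (fun x => 'D_(delta_mx 0 i) f x)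
  end.

Definition smooth_on (R : realType) (d : nat) (W : normedModType R)
    (U : set 'rV[R]_d) (f : 'rV[R]_d -> W) : Prop := forall k, Ck k U f.

(* A manifold is given by a chart [coord p], with domain [chart_dom p] and
   inverse [param p], around each of its points p; the atlas consists of these
   charts. Tangent vectors at p are written in the chart chosen at p, so that
   T_p M is 'rV[R]_d for every p. The record carries data only: the atlases
   constructed below are explicit ones. *)
Record manifold (R : realType) (d : nat) := Manifold {
  point :> Type;
  chart_dom : point -> set point;
  coord : point -> point -> 'rV[R]_d;
  param : point -> 'rV[R]_d -> point }.

Section Manifolds.
Context {R : realType}.

Definition local_rep d e (M : manifold R d) (N : manifold R e) (f : M -> N)
    (p : M) (x : 'rV[R]_d) : 'rV[R]_e :=
  coord (f p) (f (param p x)).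

Definition smooth_at d e (M : manifold R d) (N : manifold R e) (f : M -> N)
    (p : M) : Prop :=
  exists U : set 'rV[R]_d,
    [/\ open U, U (coord p p),
        forall x, U x -> chart_dom (f p) (f (param p x)) &
        smooth_on U (local_rep f p)].

Definition smooth d e (M : manifold R d) (N : manifold R e) (f : M -> N) :=
  forall p, smooth_at f p.

Definition differential d e (M : manifold R d) (N : manifold R e) (f : M -> N)
    (p : M) (v : 'rV[R]_d) : 'rV[R]_e :=
  'D_v (local_rep f p) (coord p p).

(* TM, with the atlas induced by that of M: a vector w at q has coordinates
   (x(q), dx(w)) in the chart x = coord p. *)
Definition tangent d (M : manifold R d) : manifold R (d + d) :=
  @Manifold R (d + d) (M * 'rV[R]_d)%type
    (fun u => [set u' | chart_dom u.1 u'.1])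
    (fun u u' => row_mx (coord u.1 u'.1)
       ('D_(u'.2) (fun x => coord u.1 (param u'.1 x)) (coord u'.1 u'.1)))
    (fun u z => let q := param u.1 (lsubmx z) in
       (q, 'D_(rsubmx z) (fun x => coord q (param u.1 x)) (lsubmx z))).

Definition base_point d (M : manifold R d) : tangent M -> M := fun u => u.1.

Definition tangent_map d e (M : manifold R d) (N : manifold R e) (f : M -> N) :
    tangent M -> tangent N :=
  fun u => (f u.1, differential f u.1 u.2).

Definition vector_field d (M : manifold R d) := M -> 'rV[R]_d.

Definition section_of d (M : manifold R d) (X : vector_field M) :
    M -> tangent M := fun p => (p, X p).

Definition smooth_field d (M : manifold R d) (X : vector_field M) :=
  smooth (section_of X).

End Manifolds.

(* The triple (M, h, nabla); [nabla X Y] is the covariant derivative of Y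
   along X. Only the data are recorded: flatness of nabla and of its dual is a
   property of the triples constructed below, and the notions of this section
   depend on the triple alone. *)
Record metric_connection (R : realType) (d : nat) := MetricConnection {
  mc_manifold :> manifold R d;
  mc_metric : forall p : mc_manifold, 'rV[R]_d -> 'rV[R]_d -> R;
  mc_nabla : vector_field mc_manifold -> vector_field mc_manifold ->
             vector_field mc_manifold }.

(* The data of a Kaehler manifold of real dimension 2 d with an action of
   T^d = R^d / Z^d, the latter given as a Z^d-periodic action of R^d. *)
Record toric_kahler (R : realType) (d : nat) := ToricKahler {
  tk_manifold :> manifold R (d + d);
  tk_metric : forall y : tk_manifold, 'rV[R]_(d + d) -> 'rV[R]_(d + d) -> R;
  tk_J : forall y : tk_manifold, 'rV[R]_(d + d) -> 'rV[R]_(d + d);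
  tk_act : 'rV[R]_d -> tk_manifold -> tk_manifold }.

Section Torification.
Context {R : realType} {d : nat}.
Implicit Types (M : metric_connection R d) (N : toric_kahler R d).

Definition is_connector M (K : tangent M -> 'rV[R]_(d + d) -> 'rV[R]_d) :=
  (forall u, linear (K u)) /\
  forall X Y : vector_field M, smooth_field X -> smooth_field Y ->
  forall p : M,
    K (section_of Y p) (differential (section_of Y) p (X p)) =
    mc_nabla X Y p.

Definition dombrowski_metric M
    (K : tangent M -> 'rV[R]_(d + d) -> 'rV[R]_d) (u : tangent M)
    (A B : 'rV[R]_(d + d)) : R :=
  let pi_ := differential (@base_point R d M) u in
  mc_metric (base_point u) (pi_ A) (pi_ B) +
  mc_metric (base_point u) (K u A) (K u B).

(* [dombrowski_J K u A B] : B = J_u A, where J (v, w) = (- w, v) under the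
   identification A |-> (pi_* A, K A). *)
Definition dombrowski_J M
    (K : tangent M -> 'rV[R]_(d + d) -> 'rV[R]_d) (u : tangent M)
    (A B : 'rV[R]_(d + d)) : Prop :=
  let pi_ := differential (@base_point R d M) u in
  pi_ B = - K u A /\ K u B = pi_ A.

Definition parallel_field M (X : vector_field M) : Prop :=
  smooth_field X /\
  forall Y : vector_field M, smooth_field Y -> forall p, mc_nabla Y X p = 0.

Definition translate M (X : 'I_d -> vector_field M) (t : 'rV[R]_d)
    (u : tangent M) : tangent M :=
  (u.1, u.2 + \sum_i t 0 i *: X i u.1).

Definition int_vec (k : 'I_d -> int) : 'rV[R]_d := \row_i (k i)%:~R.

Definition generates M (X : 'I_d -> vector_field M) (L : set (tangent M)) :=
  [/\ forall i, parallel_field (X i),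
      forall p : M, (\matrix_(i < d) X i p) \in unitmx &
      L = [set u : tangent M | exists k : 'I_d -> int,
             u.2 = \sum_i (k i)%:~R *: X i u.1] ].

Definition lattice_group M (L : set (tangent M)) :
    set (tangent M -> tangent M) :=
  [set gamma | exists X, generates X L /\
     exists k : 'I_d -> int, gamma = translate X (int_vec k)].

(* M_L = TM / Gamma(L) is the set of orbits [range (orbit_map L)], and
   [orbit_map L] is the quotient map q_L. *)
Definition orbit_map M (L : set (tangent M)) (u : tangent M) :
    set (tangent M) :=
  [set gamma u | gamma in lattice_group L].

Definition free_points N : set N :=
  [set y | forall t, tk_act t y = y -> exists k, t = int_vec k].
Arguments free_points : clear implicits.

(* F is a diffeomorphism from M_L onto the open set of free points. M_L has
   the quotient smooth structure, whose charts are the local inverses of q_L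
   followed by charts of TM; hence F is smooth iff F o q_L is, and F^-1 is
   smooth at y iff near y it is q_L o s with s : N -> TM smooth at y. *)
Definition quotient_diffeo M N (L : set (tangent M))
    (F : set (tangent M) -> N) : Prop :=
  [/\ set_bij (range (orbit_map L)) (free_points N) F,
      smooth (F \o orbit_map L : tangent M -> N) &
      forall y : N, free_points N y -> exists s : N -> tangent M,
        smooth_at s y /\
        \forall x \near coord y y,
          F (orbit_map L (s (param y x))) = param y x].

(* (L, X, F) is a toric parametrization. The Kaehler structure of M_L is the
   one for which q_L is a local holomorphic isometry, so the corresponding
   properties of F are those of F o q_L. *)
Definition toric_parametrization M N (L : set (tangent M))
    (X : 'I_d -> vector_field M) (F : set (tangent M) -> N) : Prop :=
  let tau : tangent M -> N := F \o orbit_map L in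
  [/\ generates X L,
      quotient_diffeo L F,
      exists K, is_connector K /\ forall u : tangent M,
        (forall A B, tk_metric (tau u)
            (differential tau u A) (differential tau u B) =
          dombrowski_metric K u A B) /\
        (forall A B, dombrowski_J K u A B ->
          differential tau u B = tk_J (tau u) (differential tau u A)) &
      forall (t : 'rV[R]_d) (u : tangent M),
        F (orbit_map L (translate X t u)) = tk_act t (F (orbit_map L u))].

Definition compatible_covering M N (tau : tangent M -> N) : Prop :=
  exists L X F, @toric_parametrization M N L X F /\ tau = F \o orbit_map L.

End Torification.

Definition is_lift (R : realType) (d d' : nat)
    (M : metric_connection R d) (N : toric_kahler R d)
    (M' : metric_connection R d') (N' : toric_kahler R d')
    (m : N -> N') (f : M -> M') : Prop :=
  [/\ smooth m, smooth f &
      exists (tau : tangent M -> N) (tau' : tangent M' -> N'),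
        [/\ compatible_covering tau, compatible_covering tau' &
            forall u : tangent M, m (tau u) = tau' (tangent_map f u)] ].

Record family (R : realType) (T : finType) (d : nat) := Family {
  member :> Type;
  density : member -> T -> R;
  natural : member -> 'rV[R]_d;
  of_natural : 'rV[R]_d -> member }.

Section Families.
Context {R : realType} {T : finType} {d : nat}.
Variable E : family R T d.

Definition family_manifold : manifold R d :=
  @Manifold R d E (fun _ => setT) (fun _ => @natural _ _ _ E)
    (fun _ => @of_natural _ _ _ E).

Definition score (p : E) (i : 'I_d) (x : T) : R :=
  'D_(delta_mx 0 i) (fun theta => ln (density (of_natural E theta) x))
    (natural p).

Definition fisher (p : E) (v w : 'rV[R]_d) : R :=
  \sum_i \sum_j v 0 i * w 0 j *
    \sum_x density p x * (score p i x * score p j x).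

Definition exponential_connection (X Y : vector_field family_manifold) :
    vector_field family_manifold :=
  fun p => 'D_(X p) (fun theta => Y (of_natural E theta)) (natural p).

Definition family_geometry : metric_connection R d :=
  @MetricConnection R d family_manifold fisher exponential_connection.

End Families.

Section Softmax.
Context {R : realType} {d : nat}.

(* (t_1, ..., t_d) |-> (t_1, ..., t_d, 0) *)
Definition append0 (t : 'rV[R]_d) (i : 'I_d.+1) : R :=
  if unlift ord_max i is Some j then t 0 j else 0.

Definition log_partition (t : 'rV[R]_d) : R := ln (1 + \sum_i expR (t 0 i)).

Definition softmax (t : 'rV[R]_d) (i : 'I_d.+1) : R :=
  expR (append0 t i - log_partition t).

Definition log_ratios (w : 'I_d.+1 -> R) : 'rV[R]_d :=
  \row_i ln (w (lift ord_max i) / w ord_max).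

End Softmax.

Definition is_prob (R : realType) (T : finType) (p : T -> R) : Prop :=
  (forall x, 0 < p x) /\ \sum_x p x = 1.

Lemma softmax_prob (R : realType) (d : nat) (t : 'rV[R]_d) :
  is_prob (softmax t).
Proof.
split=> [i|]; first exact: expR_gt0.
have Z0 : 0 < 1 + \sum_i expR (t 0 i) :> R.
  by rewrite ltr_wpDr // sumr_ge0 // => i _; apply: expR_ge0.
under eq_bigr => i _ do rewrite /softmax expRD expRN /log_partition lnK ?posrE //.
rewrite -mulr_suml (bigD1_ord ord_max) //= /append0 unlift_none expR0.
under eq_bigr => i _ do rewrite liftK.
by rewrite mulfV // gt_eqF.
Qed.

(* An ordering of T: the sequence x_1, ..., x_N and the rank of an element. *)
Record ordering (T : finType) (N : nat) := Ordering {
  nth_elt : 'I_N -> T;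
  rank : T -> 'I_N;
  nth_eltK : cancel nth_elt rank;
  rankK : cancel rank nth_elt }.

Section PositiveProbabilities.
Context {R : realType} {T : finType} {d : nat}.
Variable e : ordering T d.+1.

Definition positive_prob := {p : {ffun T -> R} | is_prob p}.

Lemma softmax_rank_prob (t : 'rV[R]_d) :
  is_prob [ffun x => softmax t (rank e x)].
Proof.
have [h1 h2] := softmax_prob t.
split=> [x|]; first by rewrite ffunE.
under eq_bigr => x _ do rewrite ffunE.
rewrite (reindex (nth_elt e)) /=; last first.
  by exists (rank e) => x _; rewrite ?nth_eltK ?rankK.
by under eq_bigr => i _ do rewrite nth_eltK.
Qed.

Definition positive_prob_family : family R T d :=
  @Family R T d positive_prob (fun p => sval p)
    (fun p => log_ratios (fun i => sval p (nth_elt e i)))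
    (fun t => exist (fun p : {ffun T -> R} => is_prob p) _
      (softmax_rank_prob t)).

End PositiveProbabilities.

Arguments positive_prob : clear implicits.

(* Omega_{m+1,n}; each k_i is at most n, whence the finite range. *)
Definition Omega (m n : nat) : finType :=
  {k : {ffun 'I_m.+1 -> 'I_n.+1} | (\sum_i k i)%N == n}.

Lemma card_Omega (m n : nat) : #|Omega m n| = 'C(m + n, m).
Proof.
rewrite card_sig -(card_ord_partitions m n).
pose g (t : m.+1.-tuple 'I_n.+1) := [ffun i => tnth t i].
have gK : cancel g (fun f => [tuple f i | i < m.+1]).
  by move=> t; apply: eq_from_tnth => i; rewrite tnth_mktuple ffunE.
rewrite -(card_imset _ (can_inj gK)); apply: eq_card => f; rewrite !inE.
apply/idP/imsetP => [fn|[t]].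
  exists [tuple f i | i < m.+1]; last first.
    by apply/ffunP => i; rewrite ffunE tnth_mktuple.
  rewrite inE big_tuple; under eq_bigr => i _ do rewrite tnth_mktuple.
  exact: fn.
rewrite inE big_tuple => tn ->; under eq_bigr => i _ do rewrite ffunE.
exact: tn.
Qed.

Section Multinomial.
Context {R : realType} {m n : nat}.

Definition multinomial_coef (k : Omega m n) : R :=
  n`!%:R / \prod_i (val k i)`!%:R.

Definition multinomial_density (w : 'I_m.+1 -> R) : {ffun Omega m n -> R} :=
  [ffun k : Omega m n => multinomial_coef k * \prod_i w i ^+ val k i].

Definition multinomial :=
  {p : {ffun Omega m n -> R} |
    exists w : 'I_m.+1 -> R, is_prob w /\ p = multinomial_density w}.

(* For n > 0 the probability vector (pi_i) of a distribution is unique. *)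
Definition weights (p : multinomial) : 'I_m.+1 -> R := sval (cid (svalP p)).

Definition multinomial_softmax (t : 'rV[R]_m) : multinomial :=
  exist _ (multinomial_density (softmax t))
    (ex_intro _ (softmax t) (conj (softmax_prob t) erefl)).

Definition multinomial_family : family R (Omega m n) m :=
  @Family R (Omega m n) m multinomial (fun p => sval p)
    (fun p => log_ratios (weights p)) multinomial_softmax.

End Multinomial.

Arguments multinomial : clear implicits.
Arguments multinomial_family : clear implicits.

Lemma multinomial_theorem (R : realType) (m n : nat) (w : 'I_m.+1 -> R) :
  \sum_(k : Omega m n) multinomial_coef k * \prod_i w i ^+ val k i =
  (\sum_i w i) ^+ n.
Proof.
have h0 j : (j`!%:R : R) != 0 by rewrite pnatr_eq0 -lt0n fact_gt0.
pose E i : {poly R} := \sum_(j < n.+1) (w i ^+ j / j`!%:R) *: 'X^j.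
have coefE i j : (j <= n)%N -> (E i)`_j = w i ^+ j / j`!%:R.
  move=> jn; rewrite coef_sum (bigD1 (inord j)) //= big1 ?addr0.
    by rewrite coefZ coefXn inordK // eqxx mulr1.
  move=> l /eqP ne; rewrite coefZ coefXn.
  case: eqP => [jl|_]; last by rewrite mulr0.
  by case: ne; apply: val_inj; rewrite /= inordK // -jl.
have prodE (s : seq 'I_m.+1) j : (j <= n)%N ->
    (\prod_(i <- s) E i)`_j = (\sum_(i <- s) w i) ^+ j / j`!%:R.
  elim: s j => [|i s IHs] j jn.
    rewrite !big_nil coef1 expr0n.
    by case: eqP => [->|_]; rewrite ?divr1 ?mul0r.
  rewrite !big_cons coefMr exprDn mulr_suml; apply: eq_bigr => l _.
  have lj : (l <= j)%N by rewrite -ltnS.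
  rewrite coefE ?IHs ?(leq_trans _ jn) ?leq_subr //.
  rewrite -(bin_fact lj) !natrM -mulr_natr.
  have := h0 l; have := h0 (j - l)%N.
  have : ('C(j, l)%:R : R) != 0 by rewrite pnatr_eq0 -lt0n bin_gt0.
  by move=> h1 h2 h3; field; rewrite h1 h2 h3.
have := prodE (enum 'I_m.+1) n (leqnn n); rewrite !big_enum /= => hp.
have -> : (\sum_i w i) ^+ n = n`!%:R * (\prod_i E i)`_n.
  by rewrite hp mulrCA mulfV ?mulr1.
rewrite bigA_distr_bigA /= coef_sum mulr_sumr.
under [RHS]eq_bigr => f _.
  rewrite scaler_prod -(big_morph _ (exprD 'X) (expr0 _)) coefZ coefXn eq_sym.
  over.
rewrite [RHS](bigID (fun f : {ffun 'I_m.+1 -> 'I_n.+1} =>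
  (\sum_i f i)%N == n)) /=.
rewrite [X in _ = _ + X]big1 ?addr0; last by move=> f /negbTE ->; rewrite !mulr0.
rewrite (reindex_omap (val : Omega m n -> _) insub) /=; last first.
  by move=> f hf; rewrite insubT.
apply: eq_big => [k|k _]; first by rewrite (valP k) valK eqxx.
rewrite (eqP (valP k)) eqxx mulr1 /multinomial_coef prodf_div.
by rewrite mulrA mulrAC.
Qed.

Lemma multinomial_coef_gt0 (R : realType) (m n : nat) (k : Omega m n) :
  0 < multinomial_coef k :> R.
Proof.
by rewrite divr_gt0 ?ltr0n ?fact_gt0 ?prodr_gt0 // => i _; rewrite ltr0n fact_gt0.
Qed.

Section Inclusion.
Context {R : realType} {m n : nat}.

Lemma multinomial_is_prob (p : multinomial R m n) : is_prob (sval p).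
Proof.
have [w [[w0 w1] ->]] := svalP p; split=> [k|].
  rewrite ffunE mulr_gt0 ?multinomial_coef_gt0 ?prodr_gt0 // => i _.
  exact: exprn_gt0.
under eq_bigr => k _ do rewrite ffunE.
by rewrite multinomial_theorem w1 expr1n.
Qed.

Definition inclusion (p : multinomial R m n) : positive_prob R (Omega m n) :=
  exist (fun q : {ffun Omega m n -> R} => is_prob q) (sval p)
    (multinomial_is_prob p).

End Inclusion.

Section ProjectiveSpace.
Context {R : realType} {n : nat}.
Notation C := R[i].

Definition projective := {W : {vspace 'rV[C]_n.+1} | \dim W == 1%N}.

Lemma dim_line_ones :
  \dim <[(const_mx 1 : 'rV[C]_n.+1)]>%VS == 1%N.
Proof.
rewrite dim_vline; suff -> : const_mx 1 != 0 :> 'rV[C]_n.+1 by [].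
by apply/rV0Pn; exists ord0; rewrite mxE oner_neq0.
Qed.

(* The point [z]; the value at z = 0 is arbitrary. *)
Definition line (z : 'rV[C]_n.+1) : projective :=
  insubd (exist (fun W : {vspace 'rV[C]_n.+1} => \dim W == 1%N) _
    dim_line_ones : projective) <[z]>%VS.

Definition rep (W : projective) : 'rV[C]_n.+1 := vpick (val W).

Lemma rep_neq0 (W : projective) : rep W != 0.
Proof.
rewrite vpick0; apply/eqP => W0.
by have := valP W; rewrite /= W0 dimv0.
Qed.

Lemma repK (W : projective) : line (rep W) = W.
Proof.
apply: val_inj; rewrite val_insubd dim_vline rep_neq0 eqxx.
apply/eqP; rewrite eqEdim dim_vline rep_neq0 (eqP (valP W)) andbT.
by rewrite -memvE memv_pick.
Qed.

Lemma rep_line (z : 'rV[C]_n.+1) :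
  z != 0 -> exists2 a, a != 0 & rep (line z) = a *: z.
Proof.
move=> z0; have : rep (line z) \in <[z]>%VS.
  rewrite (_ : <[z]>%VS = val (line z)) ?memv_pick //.
  by rewrite val_insubd dim_vline z0 eqxx.
case/vlineP=> a za; exists a => //.
by apply: contraNneq (rep_neq0 (line z)) => a0; rewrite za a0 scale0r.
Qed.

(* A homogeneous coordinate which does not vanish at W. *)
Definition pivot (W : projective) : 'I_n.+1 :=
  odflt ord0 [pick j | rep W 0 j != 0].

(* The affine chart z |-> (z_k / z_j)_(k != j), C^n being identified with
   R^(n + n) by (real parts, imaginary parts). *)
Definition affine_coord (j : 'I_n.+1) (W : projective) : 'rV[R]_(n + n) :=
  row_mx (\row_(k < n) complex.Re (rep W 0 (lift j k) / rep W 0 j))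
         (\row_(k < n) complex.Im (rep W 0 (lift j k) / rep W 0 j)).

(* The vector with j-th entry a and other entries x, as an element of C^n. *)
Definition homogenize (j : 'I_n.+1) (a : C) (x : 'rV[R]_(n + n)) :
    'rV[C]_n.+1 :=
  \row_k (if unlift j k is Some l then
            (lsubmx x 0 l +i* rsubmx x 0 l)%C else a).

Definition projective_manifold : manifold R (n + n) :=
  @Manifold R (n + n) projective
    (fun W => [set V | rep V 0 (pivot W) != 0])
    (fun W => affine_coord (pivot W))
    (fun W x => line (homogenize (pivot W) 1 x)).

Definition hermitian (u v : 'rV[C]_n.+1) : C :=
  \sum_k u 0 k * ((v 0 k)^*)%C.

(* The Fubini-Study metric of holomorphic sectional curvature c at [z], on the
   images of u and v under the differential of z |-> [z]. For n = 1 it reads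
   (4 / c) |dz|^2 / (1 + |z|^2)^2, a round sphere of Gauss curvature c. *)
Definition fubini_study (c : R) (z u v : 'rV[C]_n.+1) : R :=
  4 / c * complex.Re (hermitian u v / hermitian z z -
     hermitian u z * hermitian z v / hermitian z z ^+ 2).

Definition torus_act (t : 'rV[R]_n) (W : projective) : projective :=
  line (\row_k ((cos (2 * pi * append0 t k) +i* sin (2 * pi * append0 t k))%C
                * rep W 0 k)).

(* P_n(c) with Phi_n *)
Definition projective_space (c : R) : toric_kahler R n :=
  @ToricKahler R n projective_manifold
    (fun W a b => fubini_study c
       (homogenize (pivot W) 1 (affine_coord (pivot W) W))
       (homogenize (pivot W) 0 a) (homogenize (pivot W) 0 b))
    (fun _ a => row_mx (- rsubmx a) (lsubmx a))
    torus_act.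

End ProjectiveSpace.

Arguments projective : clear implicits.
Arguments projective_space : clear implicits.

Section Veronese.
Context {R : realType} {m n N : nat}.
Variable e : ordering (Omega m n) N.+1.

Definition veronese_coord (z : 'rV[R[i]]_m.+1) : 'rV[R[i]]_N.+1 :=
  \row_i ((Num.sqrt (multinomial_coef (nth_elt e i)))%:C%C *
          \prod_j z 0 j ^+ val (nth_elt e i) j).

Definition veronese (W : projective R m) : projective R N :=
  line (veronese_coord (rep W)).

Lemma veronese_coord_neq0 z : z != 0 -> veronese_coord z != 0.
Proof.
move=> /rV0Pn[j zj]; pose f := [ffun i : 'I_m.+1 =>
  if i == j then ord_max else ord0 : 'I_n.+1].
have hf : (\sum_i f i)%N == n.
  rewrite (bigD1 j) //= big1 => [|i /negbTE ij]; rewrite ffunE ?eqxx ?addn0 //.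
  by rewrite ij.
apply/rV0Pn; exists (rank e (exist _ f hf)).
rewrite mxE rankK mulf_neq0 //.
  rewrite eq_complex /= eqxx andbT gt_eqF // sqrtr_gt0.
  exact: multinomial_coef_gt0.
rewrite prodf_seq_neq0; apply/allP => i _ /=; rewrite ffunE.
by have [->|_] := eqVneq i j; [rewrite expf_neq0 | rewrite expr0 oner_neq0].
Qed.

Lemma veronese_line z : z != 0 -> veronese (line z) = line (veronese_coord z).
Proof.
move=> z0; have [a a0 ha] := rep_line z0.
have -> : veronese (line z) = line (a ^+ n *: veronese_coord z).
  congr line; apply/rowP => i; rewrite ha !mxE mulrCA; congr (_ * _).
  under eq_bigr => j _ do rewrite mxE exprMn.
  by rewrite big_split /= prodrXr (eqP (valP (nth_elt e i))).
apply: val_inj; rewrite !val_insubd !dim_vline scaler_eq0 expf_eq0 (negbTE a0).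
rewrite andbF /= veronese_coord_neq0 // eqxx.
apply/eqP; rewrite eqEdim !dim_vline scaler_eq0 expf_eq0 (negbTE a0) andbF /=.
by rewrite veronese_coord_neq0 // leqnn andbT -memvE memvZ ?memv_line.
Qed.

End Veronese.

(* Main.v *)
From Pilot Require Import Defs.
From mathcomp Require Import all_boot all_order all_algebra.
From mathcomp Require Import complex ring lra zify.
From mathcomp Require Import all_classical all_reals all_analysis.
(* Last, so that [coord] and [param] denote charts of manifolds. *)
Import Pilot.Defs.

(** In natural parameters theta the tangent bundle of either family is R^d x
    R^d, with coordinates (theta, v). The covering map is
      (theta, v) |-> [e^(w_1), ..., e^(w_d), 1],  w_k = (theta_k + i v_k) / 2,
    for both of them; put w_(d+1) = 0 and theta_(d+1) = 0.

    This map is compatible with the torification ([toric_map_compatible]). It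
    is holomorphic because J is multiplication of d theta + i dv by i. It is a
    local isometry because both metrics are covariances. The Fisher metric is
    the covariance of the components of tangent vectors under softmax theta,
    up to the factor 1/c with c = 1 for all positive probabilities
    ([fisher_positive_prob]) and c = 1/n for multinomial distributions, whose
    second moments are n times those of one trial ([fisher_multinomial],
    [multinomial_moment2]). The Fubini-Study metric is 4/c times the
    covariance of the logarithmic derivatives dw of the homogeneous
    coordinates under their normalized squared moduli ([fubini_study_cov]),
    and |e^(w_k)|^2 = e^(theta_k). The fibres of the covering map are the
    orbits of the lattice 4 pi Z^d in the v directions, translation by 4 pi t
    being the rotation by t; its image is the set of points all of whose
    homogeneous coordinates are nonzero, which are the points with trivial
    stabilizer ([rep_free]), and branches of the logarithm invert it locally.

    The inclusion of the multinomial family is affine in natural parameters: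
    the log-probability of k is ln (n! / k!) + sum_j k_j theta_j up to a term
    independent of k, where k! stands for the product of the k_j!. Hence it
    sends (theta, v) to the point whose k-th logarithmic coordinate is (ln (n!
    / k!)) / 2 + sum_j k_j w_j up to such a term, and the exponential of this
    is sqrt (n! / k!) times the monomial of exponent k in the e^(w_j), a
    coordinate of the Veronese embedding ([veronese_lift]).

    Smoothness is obtained from a class of elementary functions closed under
    partial derivatives. *)

Set Implicit Arguments.
Unset Strict Implicit.
Unset Printing Implicit Defensive.

Import Order.TTheory GRing.Theory Num.Theory.
Import numFieldNormedType.Exports.
Local Open Scope classical_set_scope.
Local Open Scope ring_scope.

(** * Differential calculus *)

Section Calculus.
Context {R : realType}.

(** For functions on a normed space, derivatives along [e] are ordinary
    derivatives on lines, to which one-variable calculus (chain rule, mean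
    value theorem) applies. *)
Lemma is_derive_line (V W : normedModType R) (f : V -> W) (y e : V) (s : R) :
  derivable f (s *: e + y) e ->
  is_derive s 1 (fun t : R => f (t *: e + y)) ('D_e f (s *: e + y)).
Proof.
suff E : (fun h : R => h^-1 *: (((fun t : R => f (t *: e + y)) \o shift s)
      (h *: (1 : R)) - f (s *: e + y))) =
    (fun h => h^-1 *: ((f \o shift (s *: e + y)) (h *: e) - f (s *: e + y))).
  by move=> fd; split; rewrite /derivable /derive E.
by apply/funext => h /=; rewrite [h%:A]mulr1 scalerDl addrA.
Qed.

Lemma is_derive_comp1 (V : normedModType R) (f : V -> R) (g : R -> R)
    (dg : R) (x v : V) :
  derivable f x v -> is_derive (f x) 1 g dg ->
  is_derive x v (g \o f) (dg * 'D_v f x).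
Proof.
move=> df dgf.
have df' : derivable f (0 *: v + x) v by rewrite scale0r add0r.
have dgf' : is_derive (f (0 *: v + x)) 1 g dg by rewrite scale0r add0r.
have h1 := is_derive_line df'.
have [h2 h3] := @is_derive1_comp _ _ _ _ _ _ dgf' h1.
have E : derivable (g \o f) x v by apply/derivable1P.
split=> //; have := @is_derive_line _ _ (g \o f) x v 0.
rewrite scale0r add0r => /(_ E)[_ <-].
by have := h3; rewrite scale0r add0r.
Qed.

(** The sign of [b] is left free because the increments [h * c] to which this
    is applied below change sign with [h]. *)
Lemma MVT0 (f df : R -> R) (b : R) :
  (forall c : R, `|c| <= `|b| -> is_derive c 1 f (df c)) ->
  exists2 c, `|c| <= `|b| & f b - f 0 = df c * b.
Proof.
move=> fd.
have cont c : `|c| <= `|b| -> {for c, continuous f}.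
  move=> cb; apply: differentiable_continuous; apply/derivable1_diffP.
  by have [] := fd c cb.
have [b0|b0|->] := ltrgtP b 0; last first.
- by exists 0; rewrite ?normr0 // subrr mulr0.
- have [||c cI e] := @MVT R f df 0 b b0.
  + move=> c; rewrite in_itv /= => /andP[c0 cb]; apply: fd.
    by rewrite (gtr0_norm c0) (gtr0_norm b0) ltW.
  + apply: continuous_in_subspaceT => c; rewrite inE /= in_itv /=.
    by move=> /andP[c0 cb]; apply: cont; rewrite (ger0_norm c0) (gtr0_norm b0).
  + move: cI; rewrite in_itv /= => /andP[c0 cb]; exists c.
      by rewrite (gtr0_norm c0) (gtr0_norm b0) ltW.
    by rewrite e subr0.
- have [||c cI e] := @MVT R f df b 0 b0.
  + move=> c; rewrite in_itv /= => /andP[cb c0]; apply: fd.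
    by rewrite (ltr0_norm c0) (ltr0_norm b0) lerN2 ltW.
  + apply: continuous_in_subspaceT => c; rewrite inE /= in_itv /=.
    by move=> /andP[cb c0]; apply: cont;
      rewrite (ler0_norm c0) (ltr0_norm b0) lerN2.
  + move: cI; rewrite in_itv /= => /andP[cb c0]; exists c.
      by rewrite (ltr0_norm c0) (ltr0_norm b0) lerN2 ltW.
    by rewrite -opprB e sub0r mulrN opprK.
Qed.

(** One step of the telescoping in [derivable_of_partial]: the increment along
    [delta_mx 0 i] starts at the moving point [h *: w + x], so the mean value
    theorem and the continuity of the partial derivative at [x] replace
    derivability at a fixed point. *)
Lemma continuous_partial_quotient d (f : 'rV[R]_d -> R) (x w : 'rV[R]_d)
    (i : 'I_d) (c : R) :
  (\forall y \near x, derivable f y (delta_mx 0 i)) ->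
  {for x, continuous (fun y => 'D_(delta_mx 0 i) f y)} ->
  (fun h : R => h^-1 * (f (h *: (w + c *: delta_mx 0 i) + x) -
     f (h *: w + x))) @ 0^' --> c * 'D_(delta_mx 0 i) f x.
Proof.
move=> fd fc; set e := delta_mx 0 i.
apply/cvgrPdist_le => eps eps0.
have eps1 : 0 < eps / (`|c| + 1) by rewrite divr_gt0 // ltr_wpDl.
have : \forall y \near x, derivable f y e /\
    `|'D_e f x - 'D_e f y| <= eps / (`|c| + 1).
  by apply: filterI => //; move/cvgrPdist_le : fc; apply.
move=> /nbhs_normP[r /= r0 near_x].
(* [`|h| * B] bounds the distance from x of the points met on the segment. *)
pose B := `|w| + `|c| * `|e| + 1.
have B0 : 0 < B by rewrite ltr_wpDl // addr_ge0 // mulr_ge0.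
near=> h.
have h0 : h != 0 by near: h; exact: nbhs_dnbhs_neq.
have hB : `|h| * B < r.
  rewrite -ltr_pdivlMr //; near: h; apply: dnbhs0_lt; exact: divr_gt0.
have nearP s : `|s| <= `|h * c| ->
    derivable f (s *: e + (h *: w + x)) e /\
    `|'D_e f x - 'D_e f (s *: e + (h *: w + x))| <= eps / (`|c| + 1).
  move=> sh; apply: near_x; rewrite /ball_ /= -normrN opprB.
  rewrite addrA addrK (le_lt_trans _ hB) //.
  have h1 := ler_normD (s *: e) (h *: w); rewrite !normrZ in h1.
  have h2 : `|s| * `|e| <= `|h| * `|c| * `|e|.
    by rewrite ler_wpM2r // -normrM.
  have h3 := normr_ge0 h.
  by rewrite /B; lra.
have [s sh es] : exists2 s, `|s| <= `|h * c| &
    f ((h * c) *: e + (h *: w + x)) - f (0 *: e + (h *: w + x)) =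
    'D_e f (s *: e + (h *: w + x)) * (h * c).
  apply: (@MVT0 (fun s => f (s *: e + (h *: w + x)))
    (fun s => 'D_e f (s *: e + (h *: w + x)))) => s hs.
  by apply: is_derive_line; have [] := nearP s hs.
have -> : h *: (w + c *: e) + x = (h * c) *: e + (h *: w + x).
  by rewrite scalerDr scalerA addrAC addrC addrA.
move: es; rewrite scale0r add0r => ->.
set D := (X in h^-1 * (X * _)).
rewrite (_ : h^-1 * _ = c * D); last by rewrite mulrCA mulKf // mulrC.
rewrite -mulrBr normrM.
have [_ hs] := nearP s sh.
rewrite (le_trans (ler_wpM2l (normr_ge0 c) hs)) //.
have c1 : 0 < `|c| + 1 by rewrite ltr_wpDl.
rewrite mulrA ler_pdivrMr // mulrC; apply: ler_wpM2l; first exact: ltW.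
by rewrite lerDl.
Unshelve. all: by end_near. Qed.

(** A function of class C^1 has all its directional derivatives: split the
    increment [h *: v] into increments along the coordinate axes. The iterated
    partial derivatives of [Ck] only give the derivatives along the axes,
    whereas a connection differentiates in an arbitrary direction. *)
Lemma derivable_of_partial d (f : 'rV[R]_d -> R) (x v : 'rV[R]_d) :
  (forall i, \forall y \near x, derivable f y (delta_mx 0 i)) ->
  (forall i, {for x, continuous (fun y => 'D_(delta_mx 0 i) f y)}) ->
  derivable f x v.
Proof.
move=> fd fc; rewrite (row_sum_delta v) -big_enum /=.
elim/last_ind: (enum 'I_d) => [|s i IHs].
  by rewrite big_nil; exact: derivable0.
rewrite -cats1 big_cat big_seq1 /=; set w := \sum_(j <- s) _ in IHs *.
have /cvgP := @continuous_partial_quotient d f x w i (v 0 i) (fd i) (fc i).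
move=> /(is_cvgD IHs) /=; rewrite /derivable => h.
set v' := w + v 0 i *: delta_mx 0 i in h *.
suff <- : (fun a : R => a^-1 *: ((f \o shift x) (a *: w) - f x)) +
    (fun a : R => a^-1 * (f (a *: v' + x) - f (a *: w + x))) =
    (fun a : R => a^-1 *: ((f \o shift x) (a *: v') - f x)) by [].
apply/funext => k; rewrite /GRing.add /= /GRing.scale /= -mulrDr.
by congr (_ * _); rewrite addrC addrA subrK.
Qed.

End Calculus.

Lemma near_eq_continuous (T S : topologicalType) (f g : T -> S) (x : T) :
  (\forall y \near x, f y = g y) ->
  {for x, continuous f} -> {for x, continuous g}.
Proof.
move=> fg; rewrite /prop_for /continuous_at -(nbhs_singleton fg).
by apply: cvg_trans; apply: near_eq_cvg.
Qed.

Lemma continuous_entry (R : realType) d e (j : 'I_e)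
    (f : 'rV[R]_d -> 'rV[R]_e) (x : 'rV[R]_d) :
  {for x, continuous f} -> {for x, continuous (fun y => f y 0 j)}.
Proof.
move=> fx; apply: (@continuous_comp _ _ _ f (fun M : 'rV[R]_e => M 0 j)) => //.
exact: coord_continuous.
Qed.

Lemma continuous_of_entries (R : realType) d e (f : 'rV[R]_d -> 'rV[R]_e)
    (x : 'rV[R]_d) :
  (forall j, {for x, continuous (fun y => f y 0 j)}) -> {for x, continuous f}.
Proof.
move=> cf; apply/(@cvgrPdist_le _ _ _ _ (nbhs_filter x)) => eps eps0.
have : \forall y \near x, forall j, `|f x 0 j - f y 0 j| <= eps.
  apply: (@filter_forall _ _ _ _ (nbhs_filter x)) => j.
  by move/(@cvgrPdist_le _ _ _ _ (nbhs_filter x)) : (cf j); apply.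
apply: filterS => y fy.
rewrite /Num.Def.normr /= mx_normrE (bigmax_le _ (ltW eps0)) //= => -[i j] _.
by rewrite !mxE ord1.
Qed.

Lemma Ck1_derivable (R : realType) d e (U : set 'rV[R]_d)
    (f : 'rV[R]_d -> 'rV[R]_e) (x v : 'rV[R]_d) :
  open U -> U x -> Ck 1 U f -> derivable f x v.
Proof.
move=> Uo Ux [_ fd]; apply/derivable_mxP => i j; rewrite ord1 {i}.
have nU : \forall y \near x, U y by apply: open_nbhs_nbhs.
have fij k y : U y -> derivable (fun y => f y 0 j) y (delta_mx 0 k).
  by move=> Uy; have [/(_ y Uy)/derivable_mxP + _] := fd k; apply.
apply: derivable_of_partial => k.
  by apply: filterS nU => y; exact: fij.
have [fk [fc _]] := fd k.
have E y : U y -> 'D_(delta_mx 0 k) f y 0 j =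
    'D_(delta_mx 0 k) (fun y => f y 0 j) y.
  by move=> Uy; rewrite derive_mx ?mxE //; exact: fk.
have h := @continuous_entry _ _ _ j _ _ (fc x Ux).
apply: (@near_eq_continuous _ _ (fun y => 'D_(delta_mx 0 k) f y 0 j) _ x _ h).
by apply: filterS nU => y Uy; rewrite E.
Qed.

Section Elementary.
Context {R : realType} {d : nat}.
Implicit Types U : set 'rV[R]_d.

(** Smoothness on an open set is a statement about all iterated partial
    derivatives. The maps of this file are built from finitely many real-
    analytic primitives, and the functions built in this way are closed under
    partial derivatives ([elementary_derive]), so that a single induction on
    the order of differentiation settles all of them ([elementary_smooth]).
    Closure under equality on [U] is included because a derivative is only
    known there. *)
Inductive elementary U : ('rV[R]_d -> R) -> Prop :=
| elementary_cst c : elementary U (fun _ => c)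
| elementary_coord i : elementary U (fun x => x 0 i)
| elementaryD f g : elementary U f -> elementary U g ->
    elementary U (fun x => f x + g x)
| elementaryM f g : elementary U f -> elementary U g ->
    elementary U (fun x => f x * g x)
| elementaryV f : elementary U f -> (forall x, U x -> f x != 0) ->
    elementary U (fun x => (f x)^-1)
| elementary_expR f : elementary U f -> elementary U (fun x => expR (f x))
| elementary_cos f : elementary U f -> elementary U (fun x => cos (f x))
| elementary_sin f : elementary U f -> elementary U (fun x => sin (f x))
| elementary_ln f : elementary U f -> (forall x, U x -> 0 < f x) ->
    elementary U (fun x => ln (f x))
| elementary_atan f : elementary U f -> elementary U (fun x => atan (f x))
| elementary_ext f g : (forall x, U x -> f x = g x) -> elementary U f ->
    elementary U g.

Lemma elementaryN U f : elementary U f -> elementary U (fun x => - f x).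
Proof.
move=> ef; apply: elementary_ext (elementaryM (elementary_cst U (-1)) ef).
by move=> x _; rewrite mulN1r.
Qed.

Lemma elementaryB U f g : elementary U f -> elementary U g ->
  elementary U (fun x => f x - g x).
Proof. by move=> ef eg; apply: elementaryD => //; exact: elementaryN. Qed.

Lemma elementary_sum U (I : Type) (r : seq I) (F : I -> 'rV[R]_d -> R) :
  (forall i, elementary U (F i)) -> elementary U (fun x => \sum_(i <- r) F i x).
Proof.
move=> eF; elim: r => [|i r IHr].
  by apply: elementary_ext (elementary_cst U 0) => x _; rewrite big_nil.
by apply: elementary_ext (elementaryD (eF i) IHr) => x _; rewrite big_cons.
Qed.

Lemma elementary_sub U V f : V `<=` U -> elementary U f -> elementary V f.
Proof.
move=> VU; elim=> {f}; try by constructor.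
- by move=> f ef ef' f0; apply: elementaryV => // x /VU; exact: f0.
- by move=> f ef ef' f0; apply: elementary_ln => // x /VU; exact: f0.
- move=> f g fg _; apply: elementary_ext => x /VU; exact: fg.
Qed.

(** Directional derivability in all directions, together with continuity, is
    what each rule of differentiation transports: along a line, composition
    with a primitive is the chain rule in one variable. *)
Lemma elementary_derive U f : open U -> elementary U f ->
  [/\ forall x, U x -> {for x, continuous f},
      forall x v, U x -> derivable f x v &
      forall v, elementary U ('D_v f)].
Proof.
move=> Uo; elim=> {f}.
- move=> c; split=> [x _|x v _|v]; first exact: cst_continuous.
    exact: derivable_cst.
  by apply: elementary_ext (elementary_cst U 0) => x _; rewrite derive_cst.
- move=> i; split=> [x _|x v _|v]; first exact: coord_continuous.
    by have /derivable_mxP := @derivable_id _ _ x v; apply.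
  apply: elementary_ext (elementary_cst U (v 0 i)) => x _.
  have := @derive_mx R _ 1 d id x v (@derivable_id _ _ x v).
  by rewrite derive_id => {1}->; rewrite mxE.
- move=> f g _ [cf df ef] _ [cg dg eg]; split=> [x Ux|x v Ux|v].
  + by apply: (@continuousD _ _ _ f g); [exact: cf|exact: cg].
  + by apply: (@derivableD _ _ _ f g); [exact: df|exact: dg].
  apply: elementary_ext (elementaryD (ef v) (eg v)) => x Ux.
  by rewrite [RHS](@deriveD _ _ _ f g) //; [exact: df|exact: dg].
- move=> f g hf [cf df ef] hg [cg dg eg]; split=> [x Ux|x v Ux|v].
  + by apply: (@continuousM _ _ f g); [exact: cf|exact: cg].
  + by apply: (@derivableM _ _ f g); [exact: df|exact: dg].
  apply: elementary_ext
    (elementaryD (elementaryM hf (eg v)) (elementaryM hg (ef v))) => x Ux.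
  by rewrite [RHS](@deriveM _ _ f g) //; [exact: df|exact: dg].
- move=> f hf [cf df ef] f0; split=> [x Ux|x v Ux|v].
  + by apply: (@continuousV _ _ f); [exact: f0|exact: cf].
  + by apply: (@derivableV _ _ f); [exact: f0|exact: df].
  have hV := elementaryV hf f0.
  apply: elementary_ext (elementaryN (elementaryM (elementaryM hV hV) (ef v))).
  move=> x Ux; rewrite [RHS](@deriveV _ _ f) ?f0 //; last exact: df.
  by rewrite /GRing.scale /= -mulNr expr2 invfM.
- move=> f hf [cf df ef]; split=> [x Ux|x v Ux|v].
  + by apply: (@continuous_comp _ _ _ f expR); [exact: cf|exact: continuous_expR].
  + by have [] := is_derive_comp1 (df x v Ux) (is_derive_expR (f x)).
  apply: elementary_ext (elementaryM (elementary_expR hf) (ef v)) => x Ux.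
  by have [_ ->] := is_derive_comp1 (df x v Ux) (is_derive_expR (f x)).
- move=> f hf [cf df ef]; split=> [x Ux|x v Ux|v].
  + by apply: (@continuous_comp _ _ _ f cos); [exact: cf|exact: continuous_cos].
  + by have [] := is_derive_comp1 (df x v Ux) (is_derive_cos (f x)).
  apply: elementary_ext (elementaryM (elementaryN (elementary_sin hf)) (ef v)).
  move=> x Ux.
  by have [_ ->] := is_derive_comp1 (df x v Ux) (is_derive_cos (f x)).
- move=> f hf [cf df ef]; split=> [x Ux|x v Ux|v].
  + by apply: (@continuous_comp _ _ _ f sin); [exact: cf|exact: continuous_sin].
  + by have [] := is_derive_comp1 (df x v Ux) (is_derive_sin (f x)).
  apply: elementary_ext (elementaryM (elementary_cos hf) (ef v)) => x Ux.
  by have [_ ->] := is_derive_comp1 (df x v Ux) (is_derive_sin (f x)).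
- move=> f hf [cf df ef] f0; split=> [x Ux|x v Ux|v].
  + apply: (@continuous_comp _ _ _ f (@ln R) x); [exact: cf|].
    by apply: continuous_ln; exact: f0.
  + by have [] := is_derive_comp1 (df x v Ux) (is_derive1_ln (f0 x Ux)).
  have fn x : U x -> f x != 0 by move=> Ux; rewrite gt_eqF ?f0.
  apply: elementary_ext (elementaryM (elementaryV hf fn) (ef v)) => x Ux.
  by have [_ ->] := is_derive_comp1 (df x v Ux) (is_derive1_ln (f0 x Ux)).
- move=> f hf [cf df ef]; split=> [x Ux|x v Ux|v].
  + by apply: (@continuous_comp _ _ _ f atan); [exact: cf|exact: continuous_atan].
  + by have [] := is_derive_comp1 (df x v Ux) (is_derive1_atan (f x)).
  have h1 := elementaryD (elementary_cst U 1) (elementaryM hf hf).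
  have h0 x : U x -> 1 + f x * f x != 0.
    by move=> _; rewrite gt_eqF // ltr_wpDr // -expr2 sqr_ge0.
  apply: elementary_ext (elementaryM (elementaryV h1 h0) (ef v)) => x Ux.
  have [_ ->] := is_derive_comp1 (df x v Ux) (is_derive1_atan (f x)).
  by rewrite expr2.
- move=> f g fg _ [cf df ef].
  have nfg x : U x -> \forall y \near x, f y = g y.
    move=> Ux; have : \forall y \near x, U y by apply: open_nbhs_nbhs.
    by apply: filterS => y; exact: fg.
  split=> [x Ux|x v Ux|v].
  + by apply: (near_eq_continuous (nfg x Ux)); exact: cf.
  + by apply: (near_eq_derivable (nfg x Ux)); exact: df.
  by apply: elementary_ext (ef v) => x Ux; apply: near_eq_derive; exact: nfg.
Qed.

Lemma elementary_smooth e U (f : 'rV[R]_d -> 'rV[R]_e) : open U ->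
  (forall j, elementary U (fun x => f x 0 j)) -> smooth_on U f.
Proof.
move=> Uo + k; elim: k f => [|k IHk] f ef.
all: split=> //.
1,2: move=> x Ux; apply: continuous_of_entries => j.
1,2: by have [cf _ _] := elementary_derive Uo (ef j); exact: cf.
have df x v : U x -> derivable f x v.
  move=> Ux; apply/derivable_mxP => i j; rewrite ord1 {i}.
  by have [_ df _] := elementary_derive Uo (ef j); exact: df.
move=> i; split=> [x Ux|]; first exact: df.
apply: IHk => j; have [_ _ /(_ (delta_mx 0 i))] := elementary_derive Uo (ef j).
by apply: elementary_ext => x Ux; rewrite derive_mx ?mxE //; exact: df.
Qed.

(** Domains of charts and of branches of the logarithm are of this form. *)
Lemma open_elementary_gt0 (I : finType) U (f : I -> 'rV[R]_d -> R) : open U ->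
  (forall i, elementary U (f i)) -> open [set x | U x /\ forall i, 0 < f i x].
Proof.
move=> Uo ef; rewrite openE => x [Ux fx]; apply: filterI.
  by apply: open_nbhs_nbhs.
apply: (@filter_forall _ _ _ _ (nbhs_filter x)) => i.
have [cf _ _] := elementary_derive Uo (ef i).
exact: (cf x Ux _ (lt_nbhsr (fx i))).
Qed.

End Elementary.

(** * Complex exponential and logarithm *)

Section ComplexExponential.
Context {R : realType}.
Local Notation C := R[i].
Implicit Types (w q : C) (x y : R).

Lemma complex_eq q q' : complex.Re q = complex.Re q' ->
  complex.Im q = complex.Im q' -> q = q'.
Proof. by case: q q' => a b [c d] /= -> ->. Qed.

Lemma Re_mulc q q' : complex.Re (q * q') =
  complex.Re q * complex.Re q' - complex.Im q * complex.Im q'.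
Proof. by case: q q' => a b [c d]. Qed.

Lemma Im_mulc q q' : complex.Im (q * q') =
  complex.Re q * complex.Im q' + complex.Im q * complex.Re q'.
Proof. by case: q q' => a b [c d]. Qed.

Lemma Re_addc q q' : complex.Re (q + q') = complex.Re q + complex.Re q'.
Proof. by case: q q' => a b [c d]. Qed.

Lemma Im_addc q q' : complex.Im (q + q') = complex.Im q + complex.Im q'.
Proof. by case: q q' => a b [c d]. Qed.

Lemma Re_sum (I : Type) (r : seq I) (F : I -> C) :
  complex.Re (\sum_(i <- r) F i) = \sum_(i <- r) complex.Re (F i).
Proof.
by rewrite (big_morph _ Re_addc (erefl : complex.Re (0 : C) = 0)).
Qed.

Lemma Im_sum (I : Type) (r : seq I) (F : I -> C) :
  complex.Im (\sum_(i <- r) F i) = \sum_(i <- r) complex.Im (F i).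
Proof.
by rewrite (big_morph _ Im_addc (erefl : complex.Im (0 : C) = 0)).
Qed.

Lemma Re_mulrn q k : complex.Re (q *+ k) = k%:R * complex.Re q.
Proof.
elim: k => [|k IHk]; first by rewrite mul0r.
by rewrite mulrS Re_addc IHk -nat1r mulrDl mul1r.
Qed.

Lemma Im_mulrn q k : complex.Im (q *+ k) = k%:R * complex.Im q.
Proof.
elim: k => [|k IHk]; first by rewrite mul0r.
by rewrite mulrS Im_addc IHk -nat1r mulrDl mul1r.
Qed.

Definition sqnorm q : R := complex.Re q ^+ 2 + complex.Im q ^+ 2.

Lemma sqnorm_gt0 q : q != 0 -> 0 < sqnorm q.
Proof.
case: q => a b; rewrite eq_complex /= negb_and /sqnorm /= => /orP[a0|b0].
  by rewrite ltr_wpDr ?sqr_ge0 // exprn_even_gt0.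
by rewrite ltr_wpDl ?sqr_ge0 // exprn_even_gt0.
Qed.

Lemma sqnorm_neq0 q : 0 < sqnorm q -> q != 0.
Proof. by apply: contraTneq => ->; rewrite /sqnorm /= expr0n addr0 ltxx. Qed.

Definition cexp w : C :=
  ((expR (complex.Re w) * cos (complex.Im w)) +i*
   (expR (complex.Re w) * sin (complex.Im w)))%C.

Lemma cexpD w w' : cexp (w + w') = cexp w * cexp w'.
Proof.
by case: w w' => a b [c d]; apply: complex_eq;
  rewrite /= expRD ?cosD ?sinD; ring.
Qed.

Lemma cexp0 : cexp 0 = 1.
Proof. by rewrite /cexp /= expR0 cos0 sin0 mulr1 mulr0. Qed.

Lemma cexp_neq0 w : cexp w != 0.
Proof.
apply/eqP => w0; have := cexpD w (- w); rewrite w0 mul0r subrr cexp0 => /eqP.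
by rewrite oner_eq0.
Qed.

Lemma cexpB w w' : cexp (w - w') = cexp w / cexp w'.
Proof.
by apply: (mulIf (cexp_neq0 w')); rewrite -cexpD subrK divfK ?cexp_neq0.
Qed.

Lemma cexpMn w k : cexp (w *+ k) = cexp w ^+ k.
Proof. by elim: k => [|k IHk]; rewrite ?cexp0 // mulrS cexpD IHk exprS. Qed.

Lemma cexp_sum (I : Type) (r : seq I) (F : I -> C) :
  cexp (\sum_(i <- r) F i) = \prod_(i <- r) cexp (F i).
Proof. by rewrite (big_morph _ cexpD cexp0). Qed.

Lemma sqnorm_cexp w : sqnorm (cexp w) = expR (2 * complex.Re w).
Proof.
rewrite /sqnorm /= !exprMn -mulrDr cos2Dsin2 mulr1 -expRM_natl //.
Qed.

Lemma cexp_real x : cexp x%:C%C = (expR x)%:C%C.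
Proof. by rewrite /cexp /= cos0 sin0 mulr1 mulr0. Qed.

Lemma cexp_period (k : int) : cexp (0 +i* (2 * pi * k%:~R))%C = 1.
Proof.
have nat_case (j : nat) : cexp (0 +i* (2 * pi * j%:R))%C = 1.
  rewrite /cexp /= expR0 !mul1r; have := @cosD2pi R; have := @sinD2pi R.
  move=> /periodicn/(_ j 0) s /periodicn/(_ j 0) c.
  rewrite (_ : 2 * pi * j%:R = 0 + pi *+ 2 *+ j) ?s ?c ?sin0 ?cos0 //.
  by rewrite add0r -[RHS]mulr_natr -[pi *+ 2]mulr_natl.
case: (intP k) => [|j|j]; first exact: (nat_case 0%N).
  exact: (nat_case j.+1).
have := cexpD (0 +i* (2 * pi * j.+1%:R))%C (0 +i* (2 * pi * (- j.+1%:Z)%:~R))%C.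
rewrite nat_case mul1r => <-; rewrite -cexp0; congr cexp.
by apply: complex_eq; rewrite /= ?addr0 // mulrNz; ring.
Qed.

Lemma cexp_eq1 w : cexp w = 1 ->
  complex.Re w = 0 /\ exists k : int, complex.Im w = 2 * pi * k%:~R.
Proof.
move=> w1; have pi0 := @pi_gt0 R.
have p0 : 0 < 2 * pi :> R by rewrite mulr_gt0.
have re0 : complex.Re w = 0.
  suff /expR_inj/eqP : expR (2 * complex.Re w) = expR 0.
    by rewrite mulf_eq0 pnatr_eq0 => /eqP.
  by rewrite -sqnorm_cexp w1 /sqnorm /= expr1n expr0n addr0 expR0.
split=> //; pose k := Num.floor (complex.Im w / (2 * pi)); exists k.
pose r := complex.Im w - 2 * pi * k%:~R.
suff : r = 0 by move/eqP; rewrite subr_eq0 => /eqP.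
have r0 : 0 <= r.
  by rewrite subr_ge0 mulrC -ler_pdivlMr // ge_floor.
have r2 : r < 2 * pi.
  have := floorD1_gt (complex.Im w / (2 * pi)).
  by rewrite -/k ltr_pdivrMr // intrD /r mulrDl mul1r ltrBlDr mulrC addrC.
have cr : cos r = 1.
  have := cexpB w (0 +i* (2 * pi * k%:~R))%C; rewrite cexp_period w1 divr1.
  case: (w) re0 @r {r0 r2} => a b /= -> /=.
  by rewrite /cexp /= subr0 expR0 !mul1r => -[].
have [rp|rp] := leP r pi.
  by apply: cos_inj; rewrite ?in_itv /= ?lexx ?r0 ?rp ?ltW // cr cos0.
(* [cos] is injective on [0, pi] only; reflect the other half of the circle. *)
suff : 2 * pi - r = 0 by move=> h; move: r2; rewrite -subr_gt0 h ltxx.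
have h2 : 0 <= 2 * pi - r <= pi by apply/andP; split; lra.
apply: cos_inj; rewrite ?in_itv //= ?lexx ?ltW //.
rewrite cosB cr cos0 -mulr_natl !mulr_natl cos2pi sin2pi.
by rewrite mul0r addr0 mulr1.
Qed.

Definition rotate (phi : R) q : C := q * (cos phi +i* (- sin phi))%C.

(** The branch of the complex logarithm on the half plane in the direction
    [phi], with imaginary part within pi/2 of [phi]. Each nonzero number lies
    in such a half plane, and [atan] suffices to define the branch there. *)
Definition clog (phi : R) q : C :=
  ((ln (sqnorm q) / 2) +i*
   (phi + atan (complex.Im (rotate phi q) / complex.Re (rotate phi q))))%C.

(** With x + i y = q e^(- i phi) and x > 0, the angle a = atan (y / x)
    satisfies |q| cos a = x and |q| sin a = y. *)
Lemma cexp_clog phi q : 0 < complex.Re (rotate phi q) -> cexp (clog phi q) = q.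
Proof.
set x := complex.Re _; set y := complex.Im (rotate phi q) => x0.
have xE : x = complex.Re q * cos phi + complex.Im q * sin phi.
  by rewrite /x Re_mulc /=; ring.
have yE : y = complex.Im q * cos phi - complex.Re q * sin phi.
  by rewrite /y Im_mulc /=; ring.
have cs := cos2Dsin2 phi.
have nE : sqnorm q = x ^+ 2 + y ^+ 2.
  rewrite xE yE /sqnorm -[LHS]mulr1 -cs; ring.
have n0 : 0 < sqnorm q by rewrite nE ltr_wpDr ?sqr_ge0 // exprn_gt0.
pose a := atan (y / x).
have ca : 0 < cos a.
  by apply: cos_gt0_pihalf; rewrite atan_gtNpi2 atan_ltpi2.
have sa : sin a * x = y * cos a.
  have := atanK (y / x); rewrite -/a /tan => /(congr1 ( *%R^~ (cos a * x))).
  have ca0 : cos a != 0 by rewrite gt_eqF.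
  have x0' : x != 0 by rewrite gt_eqF.
  by rewrite mulrA divfK // => ->; field.
pose r := expR (ln (sqnorm q) / 2).
have r2 : r ^+ 2 = sqnorm q.
  by rewrite -expRM_natl mulrC divfK // lnK.
have rc : r * cos a = x.
  have rc0 : 0 < r * cos a by rewrite mulr_gt0 ?expR_gt0.
  have /eqP : (r * cos a) ^+ 2 = x ^+ 2.
    rewrite exprMn r2 nE mulrDl -!exprMn -sa exprMn.
    by rewrite exprMn (mulrC (x ^+ 2)) -mulrDl cos2Dsin2 mul1r.
  by rewrite eqrXn2 ?ltW // => /eqP.
have rs : r * sin a = y.
  have x0' : x != 0 by rewrite gt_eqF.
  by apply: (mulIf x0'); rewrite -mulrA sa mulrCA rc.
apply: complex_eq; rewrite /= -/a -/r ?cosD ?sinD.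
  transitivity (cos phi * (r * cos a) - sin phi * (r * sin a)); first ring.
  rewrite rc rs xE yE -[RHS]mulr1 -cs; ring.
transitivity (sin phi * (r * cos a) + cos phi * (r * sin a)); first ring.
rewrite rc rs xE yE -[RHS]mulr1 -cs; ring.
Qed.

(** One of the four directions 0, pi/2, pi, -pi/2 already works. *)
Lemma ex_rotate_gt0 q : q != 0 -> exists phi, 0 < complex.Re (rotate phi q).
Proof.
move=> q0; have E phi : complex.Re (rotate phi q) =
    complex.Re q * cos phi + complex.Im q * sin phi.
  by rewrite Re_mulc /=; ring.
have [h|h|h] := ltrgtP (complex.Re q) 0.
- by exists pi; rewrite E cospi sinpi mulr0 addr0 mulrN1 oppr_gt0.
- by exists 0; rewrite E cos0 sin0 mulr0 addr0 mulr1.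
have [h'|h'|h'] := ltrgtP (complex.Im q) 0.
- exists (- (pi / 2)); rewrite E cosN sinN cos_pihalf sin_pihalf mulr0 add0r.
  by rewrite mulrN1 oppr_gt0.
- by exists (pi / 2); rewrite E cos_pihalf sin_pihalf mulr0 add0r mulr1.
by case/eqP: q0; apply: complex_eq; rewrite ?h ?h'.
Qed.

End ComplexExponential.

Section ComplexElementary.
Context {R : realType} {d : nat}.
Local Notation C := R[i].
Implicit Types (U : set 'rV[R]_d) (f g : 'rV[R]_d -> C).

Definition celementary U f :=
  elementary U (fun x => complex.Re (f x)) /\
  elementary U (fun x => complex.Im (f x)).

Lemma celementary_cst U c : celementary U (fun _ => c).
Proof. by split; exact: elementary_cst. Qed.

Lemma celementaryM U f g : celementary U f -> celementary U g ->
  celementary U (fun x => f x * g x).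
Proof.
move=> [fr fi] [gr gi]; split.
  apply: elementary_ext (elementaryB (elementaryM fr gr) (elementaryM fi gi)).
  by move=> x _; rewrite Re_mulc.
apply: elementary_ext (elementaryD (elementaryM fr gi) (elementaryM fi gr)).
by move=> x _; rewrite Im_mulc.
Qed.

Lemma celementaryX U f k : celementary U f -> celementary U (fun x => f x ^+ k).
Proof.
move=> ef; elim: k => [|k IHk]; first exact: celementary_cst.
have [h1 h2] := celementaryM ef IHk; split.
  by apply: elementary_ext h1 => x _; rewrite exprS.
by apply: elementary_ext h2 => x _; rewrite exprS.
Qed.

Lemma celementary_prod U (I : Type) (r : seq I) (F : I -> 'rV[R]_d -> C) :
  (forall i, celementary U (F i)) ->
  celementary U (fun x => \prod_(i <- r) F i x).
Proof.
move=> eF; elim: r => [|i r IHr].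
  have [h1 h2] := celementary_cst U 1; split.
    by apply: elementary_ext h1 => x _; rewrite big_nil.
  by apply: elementary_ext h2 => x _; rewrite big_nil.
have [h1 h2] := celementaryM (eF i) IHr; split.
  by apply: elementary_ext h1 => x _; rewrite big_cons.
by apply: elementary_ext h2 => x _; rewrite big_cons.
Qed.

Lemma elementary_sqnorm U f : celementary U f ->
  elementary U (fun x => sqnorm (f x)).
Proof.
move=> [fr fi].
by apply: elementary_ext (elementaryD (elementaryM fr fr) (elementaryM fi fi)).
Qed.

Lemma celementaryV U f : celementary U f -> (forall x, U x -> f x != 0) ->
  celementary U (fun x => (f x)^-1).
Proof.
move=> ef f0; have [fr fi] := ef.
have nV : elementary U (fun x => (sqnorm (f x))^-1).
  apply: elementaryV; first exact: elementary_sqnorm.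
  by move=> x Ux; rewrite gt_eqF // sqnorm_gt0 // f0.
split; [apply: elementary_ext (elementaryM fr nV)|
        apply: elementary_ext (elementaryN (elementaryM fi nV))].
  by move=> x _; rewrite /sqnorm; case: (f x).
by move=> x _; rewrite /sqnorm; case: (f x).
Qed.

Lemma celementary_cexp U f : celementary U f ->
  celementary U (fun x => cexp (f x)).
Proof.
move=> [fr fi]; split; apply: elementaryM; try exact: elementary_expR.
  exact: elementary_cos.
exact: elementary_sin.
Qed.

Lemma celementary_clog U f phi : celementary U f ->
  (forall x, U x -> 0 < complex.Re (rotate phi (f x))) ->
  celementary U (fun x => clog phi (f x)).
Proof.
move=> ef f0.
have f0' x : U x -> f x != 0.
  move=> Ux; apply: contraTneq (f0 x Ux) => ->.
  by rewrite /rotate mul0r ltxx.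
have [rr ri] := celementaryM ef (celementary_cst U (cos phi +i* (- sin phi))%C).
split.
  apply: elementaryM; last exact: elementary_cst.
  apply: elementary_ln; first exact: elementary_sqnorm.
  by move=> x Ux; rewrite sqnorm_gt0 // f0'.
apply: elementaryD; first exact: elementary_cst.
apply: elementary_atan; apply: elementaryM => //; apply: elementaryV => //.
by move=> x Ux; rewrite gt_eqF // f0.
Qed.

End ComplexElementary.

(** * Projective space *)

Section Projective.
Context {R : realType} {n : nat}.
Local Notation C := R[i].
Implicit Types (z : 'rV[C]_n.+1) (W : projective R n) (j : 'I_n.+1).

Lemma line_scale (a : C) z : a != 0 -> line (a *: z) = line z.
Proof.
move=> a0; have [->|z0] := eqVneq z 0; first by rewrite scaler0.
have az0 : a *: z != 0 by rewrite scaler_eq0 negb_or a0.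
apply: val_inj; rewrite !val_insubd !dim_vline az0 z0 eqxx.
apply/eqP; rewrite eqEdim !dim_vline az0 z0 leqnn andbT.
by rewrite -memvE memvZ // memv_line.
Qed.

(** Points of projective space are compared through this and [line_scale],
    since the representative chosen by [rep] is only known up to a factor. *)
Lemma line_eq z z' : z != 0 -> z' != 0 -> line z = line z' ->
  exists2 a, a != 0 & z' = a *: z.
Proof.
move=> z0 z0' e; have [a a0 ha] := rep_line z0; have [b b0 hb] := rep_line z0'.
exists (b^-1 * a); first by rewrite mulf_neq0 ?invr_eq0.
by rewrite -scalerA -ha e hb scalerA mulVf ?scale1r.
Qed.

Lemma entry_neq0 z j : z 0 j != 0 -> z != 0.
Proof. by move=> zj; apply/rV0Pn; exists j. Qed.

Lemma rep_line_ratio z j k : z 0 j != 0 ->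
  rep (line z) 0 k / rep (line z) 0 j = z 0 k / z 0 j.
Proof.
move=> zj; have [a a0 ->] := rep_line (entry_neq0 zj).
by rewrite !mxE invfM mulrACA mulfV ?mul1r.
Qed.

Lemma rep_line_eq0 z k : z != 0 -> (rep (line z) 0 k == 0) = (z 0 k == 0).
Proof.
move=> z0; have [a a0 ->] := rep_line z0.
by rewrite mxE mulf_eq0 (negbTE a0).
Qed.

Lemma rep_pivot W : rep W 0 (pivot W) != 0.
Proof.
rewrite /pivot; case: pickP => [j //|h].
have /rV0Pn[j] := rep_neq0 W; by have := h j; rewrite /= => ->.
Qed.

Lemma homogenize_pivot j a (x : 'rV[R]_(n + n)) : homogenize j a x 0 j = a.
Proof. by rewrite mxE unlift_none. Qed.

Lemma homogenize_lift j a (x : 'rV[R]_(n + n)) k :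
  homogenize j a x 0 (lift j k) = (lsubmx x 0 k +i* rsubmx x 0 k)%C.
Proof. by rewrite mxE liftK. Qed.

Lemma homogenize1_neq0 j (x : 'rV[R]_(n + n)) : homogenize j 1 x != 0.
Proof. by apply: (@entry_neq0 _ j); rewrite homogenize_pivot oner_neq0. Qed.

Lemma homogenize_affine j z : z 0 j != 0 ->
  homogenize j 1 (affine_coord j (line z)) = (z 0 j)^-1 *: z.
Proof.
move=> zj; apply/rowP => k; rewrite [RHS]mxE.
case: (unliftP j k) => [l ->|->]; last by rewrite homogenize_pivot mulVf.
rewrite homogenize_lift /affine_coord row_mxKl row_mxKr !mxE.
rewrite !(rep_line_ratio _ zj) mulrC.
by apply: complex_eq.
Qed.

Lemma line_affineK j W : rep W 0 j != 0 ->
  line (homogenize j 1 (affine_coord j W)) = W.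
Proof.
move=> Wj; rewrite -{1}(repK W) homogenize_affine // line_scale ?repK //.
by rewrite invr_eq0.
Qed.

Lemma celementary_homogenize U j k :
  celementary U (fun x : 'rV[R]_(n + n) => homogenize j 1 x 0 k).
Proof.
case: (unliftP j k) => [l ->|->]; last first.
  have [h1 h2] := @celementary_cst R (n + n) U 1.
  by split; [apply: elementary_ext h1|apply: elementary_ext h2] => x _;
    rewrite homogenize_pivot.
split.
  apply: elementary_ext (elementary_coord U (lshift n l)) => x _.
  by rewrite homogenize_lift /= mxE.
apply: elementary_ext (elementary_coord U (rshift n l)) => x _.
by rewrite homogenize_lift /= mxE.
Qed.

(** A map to projective space is smooth as soon as it has elementary
    homogeneous coordinates: the domain on which the affine chart applies is
    cut out by the nonvanishing of one of them. *)
Lemma smooth_at_line d (M : manifold R d)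
    (f : M -> @projective_manifold R n) (p : M)
    (z : 'rV[R]_d -> 'rV[C]_n.+1) :
  f (param p (coord p p)) = f p ->
  (forall x, z x != 0) -> (forall x, f (param p x) = line (z x)) ->
  (forall k, celementary setT (fun x => z x 0 k)) -> smooth_at f p.
Proof.
move=> fp z0 fz ez; set j := pivot (f p).
(* The family indexed by [unit] is a single inequality. *)
pose U := [set x | setT x /\ forall _ : unit, 0 < sqnorm (z x 0 j)].
have Uo : open U.
  apply: open_elementary_gt0; first exact: openT.
  by move=> _; exact: elementary_sqnorm.
have Uj x : U x -> z x 0 j != 0 by move=> [_ /(_ tt)]; exact: sqnorm_neq0.
exists U; split=> //.
- split=> // _; apply: sqnorm_gt0.
  by rewrite -rep_line_eq0 // -fz fp rep_pivot.
- by move=> x /Uj zj /=; rewrite fz rep_line_eq0.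
have eq k : celementary U (fun x => z x 0 k / z x 0 j).
  have sub l : celementary U (fun x => z x 0 l).
    by have [h1 h2] := ez l; split; apply: elementary_sub; try eassumption.
  by apply: celementaryM => //; apply: celementaryV.
apply: elementary_smooth => // k; rewrite /local_rep /= /affine_coord -/j.
case: (splitP k) => l kl.
  have -> : k = lshift n l by apply: val_inj.
  have [h _] := eq (lift j l); apply: elementary_ext h => x /Uj zj.
  by rewrite row_mxEl mxE fz rep_line_ratio.
have -> : k = rshift n l by apply: val_inj.
have [_ h] := eq (lift j l); apply: elementary_ext h => x /Uj zj.
by rewrite row_mxEr mxE fz rep_line_ratio.
Qed.

End Projective.

(** * The Fubini-Study metric in logarithmic coordinates *)

(** The covariance of [a] and [b] under the weights [p]. It is what the Fisher
    metric of a softmax family and the Fubini-Study metric in logarithmic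
    coordinates have in common; the former is over the reals and the latter
    over the complex numbers, hence a general ring. *)
Definition cov (A : comPzRingType) (I : finType) (p a b : I -> A) : A :=
  \sum_i p i * (a i * b i) - (\sum_i p i * a i) * (\sum_i p i * b i).

Lemma cov_shift (A : comPzRingType) (I : finType) (p a b : I -> A) (a0 b0 : A) :
  \sum_i p i = 1 ->
  cov p (fun i => a i - a0) (fun i => b i - b0) = cov p a b.
Proof.
move=> p1; rewrite /cov.
have E (f : I -> A) c : \sum_i p i * (f i - c) = \sum_i p i * f i - c.
  under eq_bigr do rewrite mulrBr.
  by rewrite sumrB -mulr_suml p1 mul1r.
have -> : \sum_i p i * ((a i - a0) * (b i - b0)) =
   \sum_i p i * (a i * b i) - b0 * (\sum_i p i * a i) -
   a0 * (\sum_i p i * b i) + a0 * b0.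
  rewrite !mulr_sumr -!sumrB -[X in _ + X]mul1r -p1 mulr_suml -big_split /=.
  by apply: eq_bigr => i _; ring.
rewrite !E; ring.
Qed.

Lemma Re_cov (R : realType) (I : finType) (p : I -> R) (a b : I -> R[i]) :
  complex.Re (cov (fun i => (p i)%:C%C) a (fun i => (b i)^*%C)) =
  cov p (fun i => complex.Re (a i)) (fun i => complex.Re (b i)) +
  cov p (fun i => complex.Im (a i)) (fun i => complex.Im (b i)).
Proof.
have RB (x y : R[i]) : complex.Re (x - y) = complex.Re x - complex.Re y.
  by rewrite Re_addc; case: y.
rewrite /cov RB. rewrite Re_mulc !Re_sum !Im_sum.
have R1 (f : I -> R[i]) i :
  complex.Re ((p i)%:C%C * f i) = p i * complex.Re (f i).
  by rewrite Re_mulc /= mul0r subr0.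
have I1 (f : I -> R[i]) i :
  complex.Im ((p i)%:C%C * f i) = p i * complex.Im (f i).
  by rewrite Im_mulc /= mul0r addr0.
under eq_bigr do rewrite (R1 (fun i => a i * (b i)^*%C)).
under [X in _ - (X * _ - _)]eq_bigr do rewrite R1.
under [X in _ - (_ * X - _)]eq_bigr do rewrite (R1 (fun i => (b i)^*%C)).
under [X in _ - (_ - X * _)]eq_bigr do rewrite I1.
under [X in _ - (_ - _ * X)]eq_bigr do rewrite (I1 (fun i => (b i)^*%C)).
have -> : \sum_i p i * complex.Re (a i * (b i)^*%C) =
  \sum_i p i * (complex.Re (a i) * complex.Re (b i)) +
  \sum_i p i * (complex.Im (a i) * complex.Im (b i)).
  rewrite -big_split /=; apply: eq_bigr => i _; rewrite Re_mulc.
  by case: (a i) (b i) => ? ? [? ?] /=; ring.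
have -> : \sum_i p i * complex.Re (b i)^*%C = \sum_i p i * complex.Re (b i).
  by apply: eq_bigr => i _; case: (b i).
have -> : \sum_i p i * complex.Im (b i)^*%C = - \sum_i p i * complex.Im (b i).
  by rewrite -sumrN; apply: eq_bigr => i _; case: (b i) => ? ? /=; ring.
ring.
Qed.

(** A tangent vector which multiplies the k-th homogeneous coordinate by [a k]
    is the logarithmic derivative [a]; dividing by the squared norm of [z]
    turns the squared moduli of the coordinates into probabilities, and
    subtracting the component along [z] centers [a]. The value is the
    covariance of the logarithmic derivatives. *)
Lemma fubini_study_cov (R : realType) n (c : R) (z : 'rV[R[i]]_n.+1)
    (a b : 'I_n.+1 -> R[i]) : z != 0 ->
  fubini_study c z (\row_k (a k * z 0 k)) (\row_k (b k * z 0 k)) =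
  4 / c * complex.Re (cov
    (fun k => (sqnorm (z 0 k) / \sum_l sqnorm (z 0 l))%:C%C)
    a (fun k => (b k)^*%C)).
Proof.
move=> z0; rewrite /fubini_study; congr (_ * complex.Re _).
set S := \sum_l _.
have S0 : S != 0.
  have /rV0Pn[j zj] := z0; rewrite gt_eqF // /S (bigD1 j) //=.
  rewrite ltr_pwDl ?sqnorm_gt0 // sumr_ge0 // => i _.
  by rewrite addr_ge0 ?sqr_ge0.
have S0C : S%:C%C != 0.
  by rewrite -(rmorph0 (real_complex R)) (inj_eq (@complexI R)).
have mJ q : q * q^*%C = (sqnorm q)%:C%C :> R[i].
  by case: q => x y; apply: complex_eq; rewrite /sqnorm /=; ring.
have zz : hermitian z z = S%:C%C.
  by rewrite /hermitian /S rmorph_sum; apply: eq_bigr => k _; rewrite mJ.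
have pE k : (sqnorm (z 0 k) / S)%:C%C = z 0 k * (z 0 k)^*%C / S%:C%C.
  by rewrite mJ rmorphM fmorphV.
have cM (x y : R[i]) : ((x * y)^* = x^* * y^*)%C by rewrite rmorphM.
rewrite /cov zz; congr (_ - _).
  rewrite /hermitian mulr_suml; apply: eq_bigr => k _.
  by rewrite !mxE pE cM; field.
rewrite expr2 invfM mulrACA; congr (_ * _).
  rewrite /hermitian mulr_suml; apply: eq_bigr => k _.
  by rewrite !mxE pE; field.
rewrite /hermitian mulr_suml; apply: eq_bigr => k _.
by rewrite !mxE pE cM; field.
Qed.

(** * Logarithmic coordinates *)

Section Append0.
Context {R : realType} {d : nat}.
Implicit Types t : 'rV[R]_d.

Lemma append0_last t : append0 t ord_max = 0.
Proof. by rewrite /append0 unlift_none. Qed.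

Lemma append0_lift t i : append0 t (lift ord_max i) = t 0 i.
Proof. by rewrite /append0 liftK. Qed.

Lemma append0P (h s : R) t t' k :
  append0 (h *: t + s *: t') k = h * append0 t k + s * append0 t' k.
Proof.
case: (unliftP ord_max k) => [i ->|->]; rewrite ?append0_lift ?append0_last.
  by rewrite !mxE.
by rewrite !mulr0 addr0.
Qed.

Lemma append0D t t' k : append0 (t + t') k = append0 t k + append0 t' k.
Proof. by have := append0P 1 1 t t' k; rewrite !scale1r !mul1r. Qed.

Lemma append0Z h t k : append0 (h *: t) k = h * append0 t k.
Proof. by have := append0P h 0 t t k; rewrite scale0r mul0r !addr0. Qed.

Lemma append0_row (f : 'I_d.+1 -> R) k :
  append0 (\row_i (f (lift ord_max i) - f ord_max)) k = f k - f ord_max.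
Proof.
case: (unliftP ord_max k) => [i ->|->]; rewrite ?append0_lift ?append0_last.
  by rewrite mxE.
by rewrite subrr.
Qed.

Lemma append0_sum t k : append0 t k = \sum_i t 0 i * append0 (delta_mx 0 i) k.
Proof.
case: (unliftP ord_max k) => [j ->|->]; rewrite ?append0_last.
  rewrite append0_lift (bigD1 j) //= append0_lift mxE !eqxx mulr1 big1 ?addr0 //.
  move=> i ij; rewrite append0_lift mxE eqxx eq_sym (negbTE ij) mulr0 //.
by rewrite big1 // => i _; rewrite append0_last mulr0.
Qed.

Lemma partitionE t : 1 + \sum_i expR (t 0 i) = \sum_k expR (append0 t k).
Proof.
rewrite [RHS](bigD1_ord ord_max) //= append0_last expR0; congr (_ + _).
by apply: eq_bigr => i _; rewrite append0_lift.
Qed.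

Lemma partition_gt0 t : 0 < \sum_k expR (append0 t k).
Proof.
rewrite -partitionE ltr_wpDr // sumr_ge0 // => i _; exact: expR_ge0.
Qed.

Lemma softmaxE t k :
  softmax t k = expR (append0 t k) / \sum_l expR (append0 t l).
Proof.
by rewrite /softmax expRB /log_partition lnK partitionE // posrE partition_gt0.
Qed.

End Append0.

Lemma is_derive_affine (R : realType) (V W : normedModType R) (f : V -> W)
    (x v : V) (s : W) :
  (forall h : R, f (h *: v + x) = h *: s + f x) -> is_derive x v f s.
Proof.
move=> fE.
have ds : (fun h : R => h^-1 *: ((f \o shift x) (h *: v) - f x)) @ 0^' --> s.
  apply: cvg_near_cst; near=> h.
  have h0 : h != 0 by near: h; exact: nbhs_dnbhs_neq.
  by rewrite /= fE addrK scalerA mulVf // scale1r.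
by split; [apply/cvg_ex; exists s|apply: cvg_lim].
Unshelve. all: by end_near. Qed.

Lemma is_derive_mx (R : realType) (V : normedModType R) m n
    (f : V -> 'M[R]_(m, n)) (x v : V) (df : 'M[R]_(m, n)) :
  (forall i j, is_derive x v (fun y => f y i j) (df i j)) ->
  is_derive x v f df.
Proof.
move=> fE; have fd : derivable f x v.
  by apply/derivable_mxP => i j; have [] := fE i j.
split=> //; rewrite derive_mx //; apply/matrixP => i j; rewrite mxE.
by have [_ ->] := fE i j.
Qed.

Lemma is_derive_cexp (R : realType) (V : normedModType R) (l : V -> R[i])
    (x v : V) (dl : R[i]) :
  is_derive x v (fun y => complex.Re (l y)) (complex.Re dl) ->
  is_derive x v (fun y => complex.Im (l y)) (complex.Im dl) ->
  is_derive x v (fun y => complex.Re (cexp (l y))) (complex.Re (dl * cexp (l x)))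
  /\
  is_derive x v (fun y => complex.Im (cexp (l y))) (complex.Im (dl * cexp (l x))).
Proof.
move=> [dr rE] [di iE].
have he := is_derive_comp1 dr (is_derive_expR (complex.Re (l x))).
have hc := is_derive_comp1 di (is_derive_cos (complex.Im (l x))).
have hs := is_derive_comp1 di (is_derive_sin (complex.Im (l x))).
rewrite rE in he; rewrite iE in hc hs.
split.
  apply: is_derive_eq (is_deriveM he hc) _.
  by rewrite Re_mulc /= /GRing.scale /=; ring.
apply: is_derive_eq (is_deriveM he hs) _.
by rewrite Im_mulc /= /GRing.scale /=; ring.
Qed.

Section LogCoordinates.
Context {R : realType} {d : nat}.
Local Notation C := R[i].
Implicit Types (x A : 'rV[R]_(d + d)) (j k : 'I_d.+1).

(** The logarithms (theta_k + i v_k) / 2 of homogeneous coordinates, where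
    theta and v are the two halves of [x] and the last coordinate is 1. The
    factor 1/2 makes the squared moduli equal to the unnormalized
    probabilities e^theta_k. *)
Definition logc x k : C :=
  (append0 (lsubmx x) k / 2 +i* (append0 (rsubmx x) k / 2))%C.

Definition zexp x : 'rV[C]_d.+1 := \row_k cexp (logc x k).

Lemma zexp_neq0 x k : zexp x 0 k != 0.
Proof. by rewrite mxE cexp_neq0. Qed.

Lemma celementary_zexp U k : celementary U (fun x => zexp x 0 k).
Proof.
have ea (f : 'rV[R]_(d + d) -> 'rV[R]_d) :
    (forall i, elementary U (fun x => f x 0 i)) ->
    elementary U (fun x => append0 (f x) k / 2).
  move=> fe; apply: elementaryM; last exact: elementary_cst.
  case: (unliftP ord_max k) => [i ->|->].
    by apply: elementary_ext (fe i) => x _; rewrite append0_lift.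
  by apply: elementary_ext (elementary_cst U 0) => x _; rewrite append0_last.
have [h1 h2] : celementary U (fun x => cexp (logc x k)).
  apply: celementary_cexp; split; apply: ea => i.
    by apply: elementary_ext (elementary_coord U (lshift d i)) => x _;
      rewrite mxE.
  by apply: elementary_ext (elementary_coord U (rshift d i)) => x _;
    rewrite mxE.
by split; [apply: elementary_ext h1|apply: elementary_ext h2] => x _;
  rewrite mxE.
Qed.

(** In an affine chart the coordinates are exponentials of differences of two
    [logc], and [logc] is linear. *)
Lemma is_derive_chart j x A :
  is_derive x A (fun y => affine_coord j (line (zexp y)))
    (row_mx
       (\row_k complex.Re ((logc A (lift j k) - logc A j) *
                           cexp (logc x (lift j k) - logc x j)))
       (\row_k complex.Im ((logc A (lift j k) - logc A j) *
                           cexp (logc x (lift j k) - logc x j)))).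
Proof.
have dlog k : is_derive x A
      (fun y => complex.Re (cexp (logc y k - logc y j)))
      (complex.Re ((logc A k - logc A j) * cexp (logc x k - logc x j))) /\
    is_derive x A
      (fun y => complex.Im (cexp (logc y k - logc y j)))
      (complex.Im ((logc A k - logc A j) * cexp (logc x k - logc x j))).
  apply: (@is_derive_cexp R _ (fun y => logc y k - logc y j)).
    apply: is_derive_affine => h.
    rewrite /GRing.scale /= linearP /= !append0D !append0Z; ring.
  apply: is_derive_affine => h.
  rewrite /GRing.scale /= linearP /= !append0D !append0Z; ring.
apply: is_derive_mx => i l; rewrite {i}ord1.
have E y k : rep (line (zexp y)) 0 k / rep (line (zexp y)) 0 j =
    cexp (logc y k - logc y j).
  by rewrite rep_line_ratio ?zexp_neq0 // !mxE cexpB.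
case: (splitP l) => k lk.
  have -> : l = lshift d k by apply: val_inj.
  rewrite row_mxEl mxE; have [h _] := dlog (lift j k).
  suff -> : (fun y => affine_coord j (line (zexp y)) 0 (lshift d k)) =
    (fun y => complex.Re (cexp (logc y (lift j k) - logc y j))) by [].
  by apply/funext => y; rewrite /affine_coord row_mxEl mxE E.
have -> : l = rshift d k by apply: val_inj.
rewrite row_mxEr mxE; have [_ h] := dlog (lift j k).
suff -> : (fun y => affine_coord j (line (zexp y)) 0 (rshift d k)) =
  (fun y => complex.Im (cexp (logc y (lift j k) - logc y j))) by [].
by apply/funext => y; rewrite /affine_coord row_mxEr mxE E.
Qed.

Lemma logcD x y k : logc (x + y) k = logc x k + logc y k.
Proof. by apply: complex_eq; rewrite /= linearD /= append0D mulrDl. Qed.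

Lemma logc_last x : logc x ord_max = 0.
Proof. by rewrite /logc !append0_last mul0r. Qed.

Lemma torus_act_line t (z : 'rV[C]_d.+1) : z != 0 ->
  torus_act t (line z) =
  line (\row_k (cexp (0 +i* (2 * pi * append0 t k))%C * z 0 k)).
Proof.
move=> z0; have [a a0 az] := rep_line z0.
rewrite -[RHS](line_scale _ a0) /torus_act.
congr line; apply/rowP => k; rewrite [LHS]mxE az [RHS]mxE [X in _ = _ * X]mxE.
rewrite [X in _ * X = _]mxE mulrCA; congr (_ * (_ * _)).
by rewrite /cexp /= expR0 !mul1r.
Qed.

(** The last coordinate of both vectors is 1, so proportional vectors are
    equal, and logarithms of equal numbers differ by multiples of 2 pi i. *)
Lemma zexp_inj x y : line (zexp x) = line (zexp y) ->
  exists k : 'I_d -> int, y = x + row_mx 0 ((4 * pi) *: int_vec k).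
Proof.
have z0 w : zexp w != 0 by apply: (@entry_neq0 _ _ _ ord_max); exact: zexp_neq0.
move=> /(line_eq (z0 x) (z0 y))[a a0 ya].
have a1 : a = 1.
  by move/rowP/(_ ord_max): ya; rewrite !mxE !logc_last cexp0 mulr1.
have e1 k : cexp (logc y k - logc x k) = 1.
  move/rowP/(_ k): ya; rewrite a1 !mxE mul1r cexpB => ->.
  by rewrite mulfV // cexp_neq0.
have /choice[k kE] : forall i : 'I_d, exists k : int,
    rsubmx y 0 i = rsubmx x 0 i + 4 * pi * k%:~R.
  move=> i; have [_ [k /= ik]] := cexp_eq1 (e1 (lift ord_max i)).
  exists k; move: ik; rewrite !append0_lift => ik; lra.
exists k; rewrite -(hsubmxK y) -[X in _ = X + _](hsubmxK x) add_row_mx addr0.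
congr row_mx; apply/rowP => i; last by rewrite kE !mxE.
have [/= ri _] := cexp_eq1 (e1 (lift ord_max i)).
by move: ri; rewrite !append0_lift => ri; lra.
Qed.

(** The period 4 pi comes from the factor 1/2 in [logc]: translating v by 4 pi
    t rotates the k-th coordinate by 2 pi t_k. *)
Lemma zexp_translate x t :
  line (zexp (x + row_mx 0 ((4 * pi) *: t))) = torus_act t (line (zexp x)).
Proof.
rewrite torus_act_line; last first.
  by apply: (@entry_neq0 _ _ _ ord_max); exact: zexp_neq0.
congr line; apply/rowP => k; rewrite !mxE logcD addrC cexpD; congr (cexp _ * _).
apply: complex_eq; rewrite /= ?row_mxKl ?row_mxKr ?append0Z; last by field.
rewrite -(scale0r (0 : 'rV_d)) append0Z; ring.
Qed.

Lemma zexp_period x (k : 'I_d -> int) :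
  line (zexp (x + row_mx 0 ((4 * pi) *: int_vec k))) = line (zexp x).
Proof.
congr line; apply/rowP => j; rewrite !mxE logcD cexpD.
rewrite [X in _ * X](_ : _ = 1) ?mulr1 //.
case: (unliftP ord_max j) => [i ->|->]; last by rewrite logc_last cexp0.
rewrite -(cexp_period (k i)); congr cexp.
apply: complex_eq; rewrite /= ?row_mxKl ?row_mxKr ?append0_lift !mxE //;
  last by field.
by rewrite mul0r.
Qed.

(** The pivot [j] contributes a constant shift of the logarithmic derivatives,
    to which the covariance is insensitive. The factor 4 of the Fubini-Study
    metric cancels the two factors 1/2 of [logc]. *)
Lemma fubini_study_zexp (c : R) j x A B :
  fubini_study c (\row_k cexp (logc x k - logc x j))
    (\row_k ((logc A k - logc A j) * cexp (logc x k - logc x j)))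
    (\row_k ((logc B k - logc B j) * cexp (logc x k - logc x j))) =
  c^-1 * (cov (softmax (lsubmx x)) (append0 (lsubmx A)) (append0 (lsubmx B)) +
          cov (softmax (lsubmx x)) (append0 (rsubmx A)) (append0 (rsubmx B))).
Proof.
set z := \row_k cexp (logc x k - logc x j).
have z0 : z != 0 by apply: (@entry_neq0 _ _ _ j); rewrite mxE cexp_neq0.
have := fubini_study_cov c (fun k => logc A k - logc A j)
  (fun k => logc B k - logc B j) z0.
have E A' : \row_k ((logc A' k - logc A' j) * z 0 k) =
    \row_k ((logc A' k - logc A' j) * cexp (logc x k - logc x j)).
  by apply/rowP => k; rewrite !mxE.
rewrite !E => ->.
have pE k : sqnorm (z 0 k) / \sum_l sqnorm (z 0 l) = softmax (lsubmx x) k.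
  have zE l : sqnorm (z 0 l) =
      expR (append0 (lsubmx x) l) / expR (append0 (lsubmx x) j).
    rewrite mxE sqnorm_cexp -expRB /=; congr expR. by field.
  rewrite zE; under eq_bigr do rewrite zE.
  rewrite -mulr_suml softmaxE invfM invrK mulrACA mulVf ?mulr1 //.
  by rewrite gt_eqF // expR_gt0.
have -> : (fun k => (sqnorm (z 0 k) / \sum_l sqnorm (z 0 l))%:C%C) =
    (fun k => (softmax (lsubmx x) k)%:C%C).
  by apply/funext => k; rewrite pE.
have -> : (fun k => ((logc B k - logc B j)^*)%C) =
    (fun k => (logc B k)^*%C - (logc B j)^*%C).
  by apply/funext => k; rewrite rmorphB.
rewrite cov_shift; last by rewrite -rmorph_sum (softmax_prob (lsubmx x)).2.
rewrite Re_cov /=.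
have cov2 (a b : 'I_d.+1 -> R) :
    cov (softmax (lsubmx x)) (fun k => a k / 2) (fun k => b k / 2) =
    cov (softmax (lsubmx x)) a b / 4.
  rewrite /cov.
  have -> : \sum_i softmax (lsubmx x) i * (a i / 2 * (b i / 2)) =
     (\sum_i softmax (lsubmx x) i * (a i * b i)) / 4.
    by rewrite mulr_suml; apply: eq_bigr => i _; field.
  have h (f : 'I_d.+1 -> R) : \sum_i softmax (lsubmx x) i * (f i / 2) =
     (\sum_i softmax (lsubmx x) i * f i) / 2.
    by rewrite mulr_suml; apply: eq_bigr => i _; field.
  by rewrite !h; field.
rewrite !cov2 -mulrDl mulrAC mulrCA mulfV ?mulr1 1?mulrC // pnatr_eq0 //.
Qed.

End LogCoordinates.

(** * Toric structure of families with softmax Fisher metric *)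

Section ToricFamily.
Context {R : realType} {T : finType} {d : nat}.
Variables (E : family R T d) (c : R).
Hypothesis d_gt0 : (0 < d)%N.
Hypothesis naturalK : cancel (@natural _ _ _ E) (@of_natural _ _ _ E).
Hypothesis of_naturalK : cancel (@of_natural _ _ _ E) (@natural _ _ _ E).
Hypothesis fisherE : forall (p : E) (v w : 'rV[R]_d),
  fisher p v w = c^-1 * cov (softmax (natural p)) (append0 v) (append0 w).

Local Notation M := (family_geometry E).
Local Notation TM := (tangent (family_geometry E)).
Local Notation N := (projective_space R d c).

Lemma tangent_coord (u u' : TM) : coord u u' = row_mx (natural u'.1) u'.2.
Proof.
rewrite /= (_ : (fun x => natural _) = id) ?derive_id //.
by apply/funext => x; rewrite of_naturalK.
Qed.

Lemma tangent_param (u : TM) z :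
  param u z = (of_natural E (lsubmx z), rsubmx z).
Proof.
rewrite /= (_ : (fun x => natural _) = id) ?derive_id //.
by apply/funext => x; rewrite of_naturalK.
Qed.

Lemma tangent_coordK (u : TM) : param u (coord u u) = u.
Proof.
rewrite tangent_coord tangent_param row_mxKl row_mxKr naturalK.
by case: u.
Qed.

(** The compatible covering map (theta, v) |-> [e^((theta_1 + i v_1) / 2),
    ..., e^((theta_d + i v_d) / 2), 1]. *)
Definition toric_map (u : TM) : N := line (zexp (row_mx (natural u.1) u.2)).

Lemma toric_map_param (u : TM) z : toric_map (param u z) = line (zexp z).
Proof. by rewrite tangent_param /toric_map /= of_naturalK hsubmxK. Qed.

Lemma toric_map_smooth : smooth (toric_map : TM -> N).
Proof.
move=> u; apply: (@smooth_at_line _ _ _ _ _ _ (@zexp R d)).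
- by rewrite tangent_coordK.
- by move=> x; apply: (@entry_neq0 _ _ _ ord_max); exact: zexp_neq0.
- by move=> x; exact: toric_map_param.
- by move=> k; exact: celementary_zexp.
Qed.

Lemma differential_toric_map (u : TM) A :
  let j := pivot (toric_map u) in
  let x := row_mx (natural u.1) u.2 in
  differential (toric_map : TM -> N) u A =
  row_mx
       (\row_k complex.Re ((logc A (lift j k) - logc A j) *
                           cexp (logc x (lift j k) - logc x j)))
       (\row_k complex.Im ((logc A (lift j k) - logc A j) *
                           cexp (logc x (lift j k) - logc x j))).
Proof.
move=> j x; rewrite /differential tangent_coord -/x.
have [_ <-] := is_derive_chart j x A; congr ('D_A _ x).
by apply/funext => z; rewrite /local_rep toric_map_param.
Qed.

Lemma homogenize_differential (u : TM) A :
  let j := pivot (toric_map u) in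
  let x := row_mx (natural u.1) u.2 in
  homogenize j 0 (differential (toric_map : TM -> N) u A) =
  \row_k ((logc A k - logc A j) * cexp (logc x k - logc x j)).
Proof.
move=> j x; rewrite differential_toric_map -/j -/x; apply/rowP => k.
rewrite [RHS]mxE; case: (unliftP j k) => [l ->|->].
  rewrite homogenize_lift row_mxKl row_mxKr !mxE.
  by apply: complex_eq.
by rewrite homogenize_pivot subrr mul0r.
Qed.

Lemma homogenize_toric_map (u : TM) j :
  let x := row_mx (natural u.1) u.2 in
  homogenize j 1 (affine_coord j (toric_map u)) =
  \row_k cexp (logc x k - logc x j).
Proof.
move=> x; rewrite homogenize_affine ?zexp_neq0 //.
by apply/rowP => k; rewrite !mxE cexpB mulrC.
Qed.

(** In natural parameters the connection is the usual derivative, so its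
    connector is the fibre component. *)
Definition connector (u : TM) (A : 'rV[R]_(d + d)) : 'rV[R]_d := rsubmx A.

Lemma connectorP : @is_connector R d M connector.
Proof.
split=> [u|X Y sX sY p]; first exact: linearP.
rewrite /connector /differential /= /exponential_connection.
set f := local_rep _ _; set v := X p; set x := natural p.
have fE y : f y = row_mx y (Y (of_natural E y)).
  rewrite /f /local_rep.
  have := @tangent_coord (section_of Y p) (section_of Y (of_natural E y)).
  by rewrite /= => ->; rewrite of_naturalK.
have df : derivable f x v.
  have [U [Uo Ux _ /(_ 1%N) sf]] := sY p.
  exact: Ck1_derivable Uo Ux sf.
rewrite derive_mx //; apply/rowP => k; rewrite !mxE.
have dY : derivable (fun y => Y (of_natural E y)) x v.
  apply/derivable_mxP => i j; rewrite ord1.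
  have /derivable_mxP/(_ 0 (rshift d j)) := df.
  suff -> : (fun y => f y 0 (rshift d j)) =
    (fun y => Y (of_natural E y) 0 j) by [].
  by apply/funext => y; rewrite fE row_mxEr.
rewrite derive_mx // mxE; congr ('D_v _ x).
by apply/funext => y; rewrite fE row_mxEr.
Qed.

Lemma differential_base_point (u : TM) A :
  differential (@base_point R d M) u A = lsubmx A.
Proof.
rewrite /differential tangent_coord.
have -> : local_rep (@base_point R d M) u = lsubmx.
  apply/funext => z; rewrite /local_rep tangent_param /=.
  exact: of_naturalK.
have [//] : is_derive (row_mx (natural u.1) u.2) A (@lsubmx R 1 d d) (lsubmx A).
by apply: is_derive_affine => h; rewrite linearP.
Qed.

Lemma toric_map_isometry (u : TM) A B :
  tk_metric (toric_map u) (differential (toric_map : TM -> N) u A)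
    (differential (toric_map : TM -> N) u B) =
  @dombrowski_metric R d M connector u A B.
Proof.
rewrite /dombrowski_metric !differential_base_point /connector.
pose j := pivot (toric_map u); pose x := row_mx (natural u.1) u.2.
transitivity (fubini_study c (\row_k cexp (logc x k - logc x j))
    (\row_k ((logc A k - logc A j) * cexp (logc x k - logc x j)))
    (\row_k ((logc B k - logc B j) * cexp (logc x k - logc x j)))).
  by congr (fubini_study c _ _ _); [exact: homogenize_toric_map|
    exact: homogenize_differential|exact: homogenize_differential].
by rewrite fubini_study_zexp row_mxKl mulrDr; congr (_ + _); rewrite -fisherE.
Qed.

(** In the coordinates (theta, v), the tensor J is multiplication of d theta +
    i dv by i, and [logc] is complex linear in d theta + i dv. *)
Lemma toric_map_holomorphic (u : TM) A B :
  @dombrowski_J R d M connector u A B ->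
  differential (toric_map : TM -> N) u B =
  tk_J (toric_map u) (differential (toric_map : TM -> N) u A).
Proof.
rewrite /dombrowski_J !differential_base_point /connector => -[lB rB].
have logcB k : logc B k = 'i%C * logc A k.
  apply: complex_eq.
    by rewrite Re_mulc /= lB -scaleN1r append0Z; ring.
  by rewrite Im_mulc /= rB; ring.
rewrite [RHS](_ : _ = row_mx
    (- rsubmx (differential (toric_map : TM -> N) u A))
    (lsubmx (differential (toric_map : TM -> N) u A))) //.
rewrite !differential_toric_map; cbv zeta; rewrite row_mxKl row_mxKr.
have BA k j x : (logc B k - logc B j) * cexp x =
    'i%C * ((logc A k - logc A j) * cexp x).
  by rewrite !logcB -mulrBr mulrA.
congr row_mx; apply/rowP => k; rewrite !mxE BA.
  by rewrite Re_mulc /= mul0r sub0r mul1r.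
by rewrite Im_mulc /= mul0r mul1r add0r.
Qed.

Definition period_field (i : 'I_d) : vector_field M :=
  fun _ => (4 * pi) *: delta_mx 0 i.

Definition period_lattice : set TM :=
  [set u : TM | exists k : 'I_d -> int,
     u.2 = \sum_i (k i)%:~R *: period_field i u.1].

Lemma sum_period_field (t : 'I_d -> R) p :
  \sum_i t i *: period_field i p = (4 * pi) *: \row_i t i.
Proof.
rewrite [X in _ *: X]row_sum_delta scaler_sumr; apply: eq_bigr => i _.
by rewrite /period_field mxE !scalerA mulrC.
Qed.

Lemma period_lattice_generates : generates period_field period_lattice.
Proof.
split=> // [i|p].
  split=> [p|Y sY p]; last by rewrite /= /exponential_connection derive_cst.
  exists setT; split=> //; first exact: openT.
  apply: elementary_smooth; first exact: openT.
  move=> j; case: (splitP j) => k jk.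
    have -> : j = lshift d k by apply: val_inj.
    apply: elementary_ext (elementary_coord setT k) => x _.
    by rewrite /local_rep tangent_coord row_mxEl /= of_naturalK.
  have -> : j = rshift d k by apply: val_inj.
  apply: elementary_ext (elementary_cst setT (period_field i p 0 k)) => x _.
  by rewrite /local_rep tangent_coord row_mxEr.
have -> : \matrix_(i < d) period_field i p = (4 * pi)%:M.
  apply/matrixP => i j; rewrite !mxE eqxx /= mulr_natr eq_sym.
  by case: (i == j).
rewrite unitmxE det_scalar unitfE expf_neq0 // mulf_neq0 ?pnatr_eq0 //.
by rewrite gt_eqF // pi_gt0.
Qed.

Lemma translate_period t (u : TM) :
  translate period_field t u = (u.1, u.2 + (4 * pi) *: t) :> TM.
Proof.
rewrite /translate; congr (_, _ + _).
rewrite (sum_period_field (fun i => t 0 i) u.1); congr (_ *: _).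
by apply/rowP => i; rewrite mxE.
Qed.

(** The group of a lattice is defined by all of its generators; any two
    generators give the same translations on a given fibre because both span
    the lattice there. *)
Lemma orbit_period (u : TM) : orbit_map period_lattice u =
  [set u' : TM | exists k : 'I_d -> int,
     u' = (u.1, u.2 + (4 * pi) *: int_vec k)].
Proof.
apply/seteqP; split=> u'.
  move=> [gamma [X [[_ _ LX] [k ->]]] <-] /=.
  have : period_lattice (u.1, \sum_i (k i)%:~R *: X i u.1).
    by rewrite LX; exists k.
  move=> [k' /= ek]; exists k'; rewrite /translate; congr (_, _ + _).
  rewrite -[RHS](sum_period_field _ u.1) -ek.
  by apply: eq_bigr => i _; rewrite mxE.
move=> [k ->]; exists (translate period_field (int_vec k)).
  by exists period_field; split; [exact: period_lattice_generates|exists k].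
exact: translate_period.
Qed.

Lemma toric_map_translate t (u : TM) :
  toric_map (u.1, u.2 + (4 * pi) *: t) = torus_act t (toric_map u).
Proof.
by rewrite /toric_map -zexp_translate add_row_mx addr0.
Qed.

Lemma toric_map_period (k : 'I_d -> int) (u : TM) :
  toric_map (u.1, u.2 + (4 * pi) *: int_vec k) = toric_map u.
Proof.
by rewrite /toric_map -[RHS](zexp_period _ k) add_row_mx addr0.
Qed.

Lemma toric_map_inj (u u' : TM) : toric_map u = toric_map u' ->
  exists k : 'I_d -> int, u' = (u.1, u.2 + (4 * pi) *: int_vec k).
Proof.
move=> /zexp_inj[k]; rewrite add_row_mx addr0 => /eq_row_mx[e1 e2]; exists k.
by case: u' e1 e2 => p v /= e1 ->; rewrite -(naturalK p) e1 naturalK.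
Qed.

Lemma int_vec0 : int_vec (fun=> 0) = 0 :> 'rV[R]_d.
Proof. by apply/rowP => i; rewrite !mxE. Qed.

Lemma orbit_translate (k : 'I_d -> int) (u : TM) :
  orbit_map period_lattice (u.1, u.2 + (4 * pi) *: int_vec k) =
  orbit_map period_lattice u.
Proof.
rewrite !orbit_period; apply/seteqP; split=> u' [l ->] /=.
  exists (fun i => k i + l i); rewrite -addrA -scalerDr; congr (_, _ + _ *: _).
  by apply/rowP => i; rewrite !mxE intrD.
exists (fun i => l i - k i); rewrite -addrA -scalerDr; congr (_, _ + _ *: _).
by apply/rowP => i; rewrite !mxE intrB addrC subrK.
Qed.

(** [toric_map] is constant on orbits, so the choice of a point does not
    matter; the value on the empty set, which is not an orbit, is arbitrary. *)
Definition quotient_map (S : set TM) : N :=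
  if pselect (exists u, S u) is left h then toric_map (sval (cid h))
  else toric_map (of_natural E 0, 0).

Lemma quotient_mapE (u : TM) :
  quotient_map (orbit_map period_lattice u) = toric_map u.
Proof.
rewrite /quotient_map orbit_period; case: pselect => [h|[]].
  by case: (cid h) => u' [k /= ->]; exact: toric_map_period.
by exists u, (fun=> 0); rewrite int_vec0 scaler0 addr0; case: (u).
Qed.

Lemma quotient_map_comp :
  (quotient_map \o orbit_map period_lattice : TM -> N) = toric_map.
Proof. by apply/funext => u; exact: quotient_mapE. Qed.

Lemma half_not_int (k : int) : 2^-1 <> k%:~R :> R.
Proof.
move=> h; have : 1 = (k * 2)%:~R :> R by rewrite intrM -h mulVf.
rewrite -[1]/(1%:~R) => /intr_inj; case: k {h} => k; rewrite -?PoszM; lia.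
Qed.

Lemma free_toric_map (u : TM) : @free_points R d N (toric_map u).
Proof.
move=> t; rewrite /= -toric_map_translate => /esym/toric_map_inj[k [e]].
exists k; move/addrI: e => /scalerI; apply.
by rewrite mulf_neq0 ?pnatr_eq0 // gt_eqF // pi_gt0.
Qed.

(** If a coordinate other than the last vanishes, half a turn of that
    coordinate fixes the point. If the last one vanishes, half a turn of all
    the others fixes it too, being multiplication by -1; in positive dimension
    this is not the trivial turn. *)
Lemma rep_free (W : N) : @free_points R d N W -> forall k, rep W 0 k != 0.
Proof.
move=> Wfree k; apply/eqP => Wk.
have rW0 : rep W != 0 := rep_neq0 W.
pose i0 : 'I_d := Ordinal d_gt0.
have act_half (t : 'rV[R]_d) :
    (exists i, t 0 i = 2^-1) -> torus_act t W <> W.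
  move=> [i ti] /Wfree[q tq]; apply: (@half_not_int (q i)).
  by rewrite -ti tq mxE.
have cexp_pi : cexp (0 +i* (2 * pi * 2^-1))%C = -1 :> R[i].
  rewrite mulrAC mulfV ?pnatr_eq0 // mul1r /cexp /= cospi sinpi expR0.
  by apply: complex_eq; rewrite /= ?mul1r ?mulr0 ?oppr0.
have cexp_00 : cexp (0 +i* (2 * pi * 0))%C = 1 :> R[i] by rewrite mulr0 cexp0.
case: (unliftP ord_max k) Wk => [i ->|->] Wk.
  apply: (act_half (2^-1 *: delta_mx 0 i)).
    by exists i; rewrite !mxE !eqxx mulr1.
  rewrite -{1}(repK W) torus_act_line // -[RHS]repK; congr line.
  apply/rowP => l; rewrite mxE.
  case: (unliftP ord_max l) => [j ->|->]; last first.
    by rewrite append0_last cexp_00 mul1r.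
  rewrite append0_lift !mxE eqxx /=.
  have [->|ji] := eqVneq j i; first by rewrite Wk mulr0.
  by rewrite mulr0 cexp_00 mul1r.
apply: (act_half (const_mx 2^-1)); first by exists i0; rewrite mxE.
rewrite -{1}(repK W) torus_act_line // -[RHS]repK.
rewrite -(line_scale (rep W) (_ : -1 != 0 :> R[i])); last first.
  by rewrite oppr_eq0 oner_neq0.
congr line; apply/rowP => l; rewrite [LHS]mxE [RHS]mxE.
case: (unliftP ord_max l) => [j ->|->]; last by rewrite Wk !mulr0.
by rewrite append0_lift mxE cexp_pi.
Qed.

(** Local inverse of [toric_map]. The branches [phi] of the logarithm, one for
    each ratio of homogeneous coordinates, depend on the point near which it
    is used, because no branch is continuous on all nonzero numbers. *)
Definition toric_section (phi : 'I_d -> R) (W : N) : TM :=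
  let q k := clog (phi k) (rep W 0 (lift ord_max k) / rep W 0 ord_max) in
  (of_natural E (\row_k (2 * complex.Re (q k))), \row_k (2 * complex.Im (q k))).

Lemma toric_sectionK phi (W : N) : rep W 0 ord_max != 0 ->
  (forall k, 0 < complex.Re (rotate (phi k)
     (rep W 0 (lift ord_max k) / rep W 0 ord_max))) ->
  toric_map (toric_section phi W) = W.
Proof.
move=> W0 Wk; rewrite /toric_map /toric_section /= of_naturalK.
rewrite -[RHS]repK -[RHS](@line_scale _ _ (rep W 0 ord_max)^-1) ?invr_eq0 //.
congr line; apply/rowP => k; rewrite [LHS]mxE [RHS]mxE.
case: (unliftP ord_max k) => [i ->|->]; last first.
  by rewrite logc_last cexp0 mulVf.
rewrite [RHS]mulrC -[RHS](cexp_clog (Wk i)); congr cexp.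
apply: complex_eq; rewrite /= ?row_mxKl ?row_mxKr append0_lift [X in X / _]mxE.
  by field.
by field.
Qed.

Lemma ex_branch (W : N) : (forall k, rep W 0 k != 0) ->
  exists phi : 'I_d -> R, forall k, 0 < complex.Re (rotate (phi k)
     (rep W 0 (lift ord_max k) / rep W 0 ord_max)).
Proof.
move=> W0; have /choice[phi phiP] : forall k : 'I_d, exists phi : R,
    0 < complex.Re (rotate phi (rep W 0 (lift ord_max k) / rep W 0 ord_max)).
  by move=> k; apply: ex_rotate_gt0; rewrite mulf_neq0 ?invr_eq0.
by exists phi.
Qed.

Lemma toric_section_smooth phi (W : N) : rep W 0 ord_max != 0 ->
  (forall k, 0 < complex.Re (rotate (phi k)
     (rep W 0 (lift ord_max k) / rep W 0 ord_max))) ->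
  smooth_at (toric_section phi : N -> TM) W /\
  \forall x \near coord W W,
    toric_map (toric_section phi (param W x)) = param W x.
Proof.
move=> W0 Wk; set j := pivot W; pose h x := homogenize j 1 x : 'rV[R[i]]_d.+1.
pose U0 := [set x | setT x /\ forall _ : unit, 0 < sqnorm (h x 0 ord_max)].
have eh V k : celementary V (fun x => h x 0 k).
  exact: celementary_homogenize.
have U0o : open U0.
  apply: open_elementary_gt0; first exact: openT.
  by move=> _; exact: elementary_sqnorm.
have U00 x : U0 x -> h x 0 ord_max != 0.
  by move=> [_ /(_ tt)]; exact: sqnorm_neq0.
pose q k x := h x 0 (lift ord_max k) / h x 0 ord_max.
have eq k : celementary U0 (q k).
  by apply: celementaryM => //; exact: celementaryV.
pose U := [set x | U0 x /\ forall k, 0 < complex.Re (rotate (phi k) (q k x))].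
have Uo : open U.
  apply: open_elementary_gt0 => // k.
  by have [] := celementaryM (eq k)
    (celementary_cst U0 (cos (phi k) +i* (- sin (phi k)))%C).
have repq x k : U0 x ->
    rep (line (h x)) 0 (lift ord_max k) / rep (line (h x)) 0 ord_max = q k x.
  by move=> /U00 hx; rewrite rep_line_ratio.
have hW : line (h (coord W W)) = W by exact/line_affineK/rep_pivot.
have UW : U (coord W W).
  have U0W : U0 (coord W W).
    split=> // _; apply: sqnorm_gt0.
    by rewrite -rep_line_eq0 ?homogenize1_neq0 // hW.
  by split=> // k; rewrite -repq // hW.
have eqU k : celementary U (fun x => clog (phi k) (q k x)).
  apply: celementary_clog => [|x [_]//].
  by have [h1 h2] := eq k; split; [apply: elementary_sub h1|
    apply: elementary_sub h2] => x [].
split.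
  exists U; split=> //; apply: elementary_smooth => // l.
  case: (splitP l) => k lk.
    have -> : l = lshift d k by apply: val_inj.
    have [hr _] := eqU k.
    apply: elementary_ext (elementaryM (elementary_cst U 2) hr) => x [Ux _].
    rewrite /local_rep tangent_coord row_mxEl /= of_naturalK mxE.
    by rewrite -repq.
  have -> : l = rshift d k by apply: val_inj.
  have [_ hi] := eqU k.
  apply: elementary_ext (elementaryM (elementary_cst U 2) hi) => x [Ux _].
  rewrite /local_rep tangent_coord row_mxEr /= mxE.
  by rewrite -repq.
have : \forall x \near coord W W, U x by apply: open_nbhs_nbhs.
apply: filterS => x [Ux Uk]; apply: toric_sectionK => [|k].
  by rewrite rep_line_eq0 ?homogenize1_neq0 // U00.
by rewrite repq.
Qed.

Lemma quotient_diffeo_toric : quotient_diffeo period_lattice quotient_map.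
Proof.
split.
- split=> [W [u _ <-]||W Wfree].
  + by rewrite quotient_mapE; exact: free_toric_map.
  + move=> S S'; rewrite !inE => -[u _ <-] [u' _ <-].
    rewrite !quotient_mapE => /toric_map_inj[k ->].
    by rewrite orbit_translate.
  + have W0 := rep_free Wfree; have [phi Wphi] := ex_branch W0.
    exists (orbit_map period_lattice (toric_section phi W)).
      by exists (toric_section phi W).
    by rewrite quotient_mapE toric_sectionK.
- by rewrite quotient_map_comp; exact: toric_map_smooth.
move=> W Wfree; have W0 := rep_free Wfree; have [phi Wphi] := ex_branch W0.
have [h1 h2] := toric_section_smooth (W0 ord_max) Wphi.
exists (toric_section phi); split=> //.
by apply: filterS h2 => x; rewrite quotient_mapE.
Qed.

(** Any family whose natural parameters are global coordinates, and whose
    Fisher metric is 1/c times the covariance of the softmax distribution, is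
    torified in positive dimension by the projective space of holomorphic
    sectional curvature c. *)
Theorem toric_map_compatible : @compatible_covering R d M N toric_map.
Proof.
exists period_lattice, period_field, quotient_map; split; last first.
  by rewrite quotient_map_comp.
split.
- exact: period_lattice_generates.
- exact: quotient_diffeo_toric.
- exists connector; split; first exact: connectorP.
  rewrite quotient_map_comp => u; split=> A B.
    exact: toric_map_isometry.
  exact: toric_map_holomorphic.
move=> t u; rewrite !quotient_mapE translate_period.
exact: toric_map_translate.
Qed.

End ToricFamily.

(** * Fisher metrics and multinomial moments *)

Section SoftmaxCalculus.
Context {R : realType} {d : nat}.
Implicit Types (t v w : 'rV[R]_d) (k : 'I_d.+1).

Lemma is_derive_sum_seq (V : normedModType R) (I : Type) (r : seq I)
    (h : I -> V -> R) (dh : I -> R) (x v : V) :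
  (forall i, is_derive x v (h i) (dh i)) ->
  is_derive x v (fun y => \sum_(i <- r) h i y) (\sum_(i <- r) dh i).
Proof.
move=> hd; elim: r => [|i r IHr].
  rewrite big_nil (_ : (fun y => _) = cst 0); first exact: is_derive_cst.
  by apply/funext => y; rewrite big_nil.
rewrite big_cons (_ : (fun y => _) = h i + (fun y => \sum_(j <- r) h j y)).
  exact: is_deriveD.
by apply/funext => y; rewrite big_cons.
Qed.

Lemma is_derive_append0 t v k :
  is_derive t v (fun x => append0 x k) (append0 v k).
Proof.
by apply: is_derive_affine => h; rewrite append0D append0Z.
Qed.

Lemma is_derive_pow (V : normedModType R) n (f : V -> R) (x v : V) (df : R) :
  is_derive x v f df ->
  is_derive x v (fun y => f y ^+ n) (n%:R * f x ^+ n.-1 * df).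
Proof.
move=> /(is_deriveX n); rewrite (_ : f ^+ n = (fun y => f y ^+ n)) //.
by apply/funext => y; rewrite exprfctE.
Qed.

Definition softmax_mean t (a : 'I_d.+1 -> R) := \sum_k softmax t k * a k.

Lemma is_derive_log_partition t v :
  is_derive t v log_partition (softmax_mean t (append0 v)).
Proof.
have he k : is_derive t v (fun x => expR (append0 x k))
    (expR (append0 t k) * append0 v k).
  have [h1 h2] := is_derive_append0 t v k.
  by have := is_derive_comp1 h1 (is_derive_expR (append0 t k)); rewrite h2.
have [hs hsE] := is_derive_sum_seq (index_enum 'I_d.+1) he.
have := is_derive_comp1 hs (is_derive1_ln (partition_gt0 t)); rewrite hsE.
rewrite (_ : _ \o _ = log_partition); last first.
  by apply/funext => x; rewrite /log_partition partitionE.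
move=> h; apply: is_derive_eq h _; rewrite mulr_sumr.
by apply: eq_bigr => k _; rewrite softmaxE; ring.
Qed.

(** The score of the softmax family in the direction [v], by
    [is_derive_ln_softmax]. *)
Definition centered t v k := append0 v k - softmax_mean t (append0 v).

Lemma is_derive_ln_softmax t v k :
  is_derive t v (fun x => ln (softmax x k)) (centered t v k).
Proof.
rewrite (_ : (fun x => _) = (fun x => append0 x k) - log_partition).
  apply: is_deriveB; [exact: is_derive_append0|exact: is_derive_log_partition].
by apply/funext => x; rewrite /softmax expRK.
Qed.

Lemma centered_sum t v k :
  centered t v k = \sum_i v 0 i * centered t (delta_mx 0 i) k.
Proof.
rewrite /centered append0_sum.
under [RHS]eq_bigr do rewrite mulrBr.
rewrite sumrB; congr (_ - _); rewrite /softmax_mean.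
under eq_bigr do rewrite append0_sum mulr_sumr.
rewrite exchange_big /=; apply: eq_bigr => i _.
by rewrite mulr_sumr; apply: eq_bigr => l _; rewrite mulrCA.
Qed.

Lemma softmax_mean_centered t v : softmax_mean t (centered t v) = 0.
Proof.
rewrite /softmax_mean; under eq_bigr do rewrite mulrBr.
by rewrite sumrB -mulr_suml (softmax_prob t).2 mul1r subrr.
Qed.

Lemma softmax_mean_cov t v w :
  softmax_mean t (fun k => centered t v k * centered t w k) =
  cov (softmax t) (append0 v) (append0 w).
Proof.
rewrite -(cov_shift _ _ (softmax_mean t (append0 v)) (softmax_mean t (append0 w))
  (softmax_prob t).2) /cov.
have := softmax_mean_centered t v; rewrite {1}/softmax_mean /centered => ->.
by rewrite mul0r subr0.
Qed.

Lemma append0_log_ratios (f : 'I_d.+1 -> R) k : (forall i, 0 < f i) ->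
  append0 (log_ratios f) k = ln (f k) - ln (f ord_max).
Proof.
move=> f0; rewrite -(append0_row (fun i => ln (f i))); congr append0.
by apply/rowP => i; rewrite !mxE ln_div ?posrE.
Qed.

Lemma log_ratiosK (f : 'I_d.+1 -> R) : is_prob f -> softmax (log_ratios f) =1 f.
Proof.
move=> [f0 f1] k; have E l : expR (append0 (log_ratios f) l) = f l / f ord_max.
  by rewrite append0_log_ratios // expRB !lnK ?posrE.
have fm : f ord_max != 0 by rewrite gt_eqF.
rewrite softmaxE E; under eq_bigr do rewrite E.
by rewrite -mulr_suml f1 mul1r invrK divfK.
Qed.

Lemma softmaxK t : log_ratios (softmax t) = t.
Proof.
apply/rowP => i; rewrite mxE /softmax -expRB expRK append0_last append0_lift.
by ring.
Qed.

End SoftmaxCalculus.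

(** [S v] is the score in the direction [v]; it is linear in [v], so the
    double sum over coordinates is a product of two of them. *)
Lemma fisher_score (R : realType) (T : finType) d (E : family R T d) (p : E)
    (S : 'rV[R]_d -> T -> R) :
  (forall i x, score p i x = S (delta_mx 0 i) x) ->
  (forall v x, S v x = \sum_i v 0 i * S (delta_mx 0 i) x) ->
  forall v w, fisher p v w = \sum_x density p x * (S v x * S w x).
Proof.
move=> sE SE v w; rewrite /fisher.
under eq_bigr do under eq_bigr do rewrite mulr_sumr.
under eq_bigr do rewrite exchange_big /=.
rewrite exchange_big /=; apply: eq_bigr => x _.
rewrite (SE v) (SE w) mulr_suml mulr_sumr; apply: eq_bigr => i _.
rewrite !mulr_sumr; apply: eq_bigr => j _.
by rewrite !sE; ring.
Qed.

Lemma sval_inj (T : Type) (P : T -> Prop) : injective (@sval T P).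
Proof.
move=> [x px] [y py] /= xy; move: px; rewrite xy => px.
by congr exist; exact: Prop_irrelevance.
Qed.

Section PositiveProbabilityGeometry.
Context {R : realType} {T : finType} {d : nat} (e : ordering T d.+1).
Local Notation E := (@positive_prob_family R T d e).

Lemma positive_prob_of_naturalK :
  cancel (@of_natural _ _ _ E) (@natural _ _ _ E).
Proof.
move=> t /=; rewrite -[RHS]softmaxK; congr log_ratios.
by apply/funext => i; rewrite ffunE nth_eltK.
Qed.

Lemma positive_prob_naturalK :
  cancel (@natural _ _ _ E) (@of_natural _ _ _ E).
Proof.
move=> p; apply: sval_inj; apply/ffunP => x /=; rewrite ffunE.
have [p0 p1] := svalP p.
rewrite log_ratiosK ?rankK //; split=> [i|]; first exact: p0.
rewrite -p1 [RHS](reindex (nth_elt e)) //.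
by exists (rank e) => y _; rewrite ?nth_eltK ?rankK.
Qed.

Lemma fisher_positive_prob (p : E) (v w : 'rV[R]_d) :
  fisher p v w = 1^-1 * cov (softmax (natural p)) (append0 v) (append0 w).
Proof.
rewrite invr1 mul1r -softmax_mean_cov.
pose S v x := centered (natural p) v (rank e x).
have sE i x : score p i x = S (delta_mx 0 i) x.
  rewrite /score (_ : (fun t => _) = (fun t => ln (softmax t (rank e x)))).
    by have [_ ->] :=
      is_derive_ln_softmax (natural p) (delta_mx 0 i) (rank e x).
  by apply/funext => t /=; rewrite ffunE.
rewrite (fisher_score sE); last by move=> u x; exact: centered_sum.
rewrite (reindex (nth_elt e)) /=; last first.
  by exists (rank e) => y _; rewrite ?nth_eltK ?rankK.
apply: eq_bigr => k _; rewrite /S nth_eltK; congr (_ * _).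
rewrite -{1}(positive_prob_naturalK p) /= ffunE.
by rewrite nth_eltK.
Qed.

End PositiveProbabilityGeometry.

Section MultinomialMoments.
Context {R : realType} {m n : nat}.
Implicit Types (w a b : 'I_m.+1 -> R) (k : Omega m n).

Definition pairing k a : R := \sum_j (val k j)%:R * a j.

(** Exponential change of weights: the generating function of the multinomial
    moments is the multinomial theorem at tilted weights, and moments are its
    derivatives at [s = 0]. *)
Definition tilt w a (s : R) : 'I_m.+1 -> R := fun j => w j * expR (s * a j).

Lemma is_derive_exp_sum (I : Type) (r : seq I) (c x : I -> R) :
  is_derive (0 : R) 1 (fun s => \sum_(i <- r) c i * expR (s * x i))
    (\sum_(i <- r) c i * x i).
Proof.
apply: is_derive_sum_seq => i.
have h : is_derive (0 : R) 1 (fun s : R => s * x i) (x i).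
  by apply: is_derive_affine => s; rewrite /GRing.scale /=; ring.
have [h1 h2] := h.
have := is_derive_comp1 h1 (is_derive_expR (0 * x i)).
rewrite h2 mul0r expR0 mul1r => h3.
exact: (is_deriveZ (c i) h3).
Qed.

Lemma multinomial_density_tilt w a s k :
  multinomial_density (tilt w a s) k =
  multinomial_density w k * expR (s * pairing k a).
Proof.
rewrite !ffunE -mulrA; congr (_ * _).
under eq_bigr do rewrite exprMn -expRM_natl.
rewrite big_split /= -expR_sum; congr (_ * expR _).
by rewrite mulr_sumr; apply: eq_bigr => j _; ring.
Qed.

Lemma multinomial_density_sum w :
  \sum_(k : Omega m n) multinomial_density w k = (\sum_j w j) ^+ n.
Proof.
by under eq_bigr do rewrite ffunE; exact: multinomial_theorem.
Qed.

Lemma multinomial_moment1 w a :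
  \sum_(k : Omega m n) multinomial_density w k * pairing k a =
  n%:R * (\sum_j w j) ^+ n.-1 * \sum_j w j * a j.
Proof.
have [_ <-] := is_derive_exp_sum (index_enum (Omega m n))
  (multinomial_density w) (fun k => pairing k a).
have h := is_derive_exp_sum (index_enum 'I_m.+1) w a.
have [_ hX] := is_derive_pow n h.
rewrite [X in derive X _ _](_ : _ = fun s => (\sum_j w j * expR (s * a j)) ^+ n);
  last first.
  apply/funext => s.
  have <- : \sum_j tilt w a s j = \sum_j w j * expR (s * a j) by [].
  rewrite -multinomial_density_sum; apply: eq_bigr => k _.
  by rewrite multinomial_density_tilt.
rewrite hX; congr (_ * _ ^+ _ * _).
by apply: eq_bigr => j _; rewrite mul0r expR0 mulr1.
Qed.

(** Differentiate [multinomial_moment1] at the weights tilted by [b]. Since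
    [a] is centered, the term coming from the derivative of the power
    vanishes. *)
Lemma multinomial_moment2 w a b : \sum_j w j = 1 -> \sum_j w j * a j = 0 ->
  \sum_(k : Omega m n) multinomial_density w k * (pairing k a * pairing k b) =
  n%:R * \sum_j w j * (a j * b j).
Proof.
move=> w1 wa0.
under eq_bigr do rewrite mulrA.
have [_ <-] := is_derive_exp_sum (index_enum (Omega m n))
  (fun k => multinomial_density w k * pairing k a) (fun k => pairing k b).
have hw := is_derive_exp_sum (index_enum 'I_m.+1) w b.
have hwa := is_derive_exp_sum (index_enum 'I_m.+1) (fun j => w j * a j) b.
set g : R -> R := fun s => \sum_j w j * expR (s * b j) in hw.
set ga : R -> R := fun s => \sum_j w j * a j * expR (s * b j) in hwa.
have hp := is_deriveZ n%:R (is_deriveM (is_derive_pow n.-1 hw) hwa).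
have g0 : g 0 = 1.
  by rewrite -[RHS]w1; apply: eq_bigr => j _; rewrite mul0r expR0 mulr1.
have ga0 : ga 0 = 0.
  by rewrite -[RHS]wa0; apply: eq_bigr => j _; rewrite mul0r expR0 mulr1.
rewrite [X in derive X _ _](_ : _ = n%:R *: ((fun s => g s ^+ n.-1) * ga));
  last first.
  apply/funext => s.
  transitivity (n%:R * g s ^+ n.-1 * ga s); last by rewrite -mulrA.
  transitivity (\sum_(k : Omega m n)
      multinomial_density (tilt w b s) k * pairing k a).
    by apply: eq_bigr => k _; rewrite multinomial_density_tilt; ring.
  rewrite multinomial_moment1; congr (_ * _).
  by apply: eq_bigr => j _; rewrite /tilt; ring.
have [_ ->] := hp.
rewrite ga0 g0 expr1n scale0r addr0 scale1r; congr (_ * _).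
by apply: eq_bigr => j _; rewrite mulrA.
Qed.

End MultinomialMoments.

(** * The family of multinomial distributions *)

Section MultinomialGeometry.
Context {R : realType} {m n : nat}.
Hypothesis n_gt0 : (0 < n)%N.
Local Notation E := (multinomial_family R m n).

(** The multi-index concentrated at j has probability w_j^n, which determines
    w_j because [n] is positive. *)
Lemma multinomial_density_inj (w w' : 'I_m.+1 -> R) : is_prob w -> is_prob w' ->
  multinomial_density w = multinomial_density w' :> {ffun Omega m n -> R} ->
  w =1 w'.
Proof.
move=> [w0 _] [w0' _] /ffunP ww' j.
pose f := [ffun i : 'I_m.+1 => if i == j then ord_max else ord0 : 'I_n.+1].
have fE i : nat_of_ord (f i) = if i == j then n else 0%N.
  by rewrite ffunE; case: eqP.
have fn : (\sum_i f i)%N == n.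
  rewrite (bigD1 j) //= fE eqxx big1 ?addn0 // => i /negbTE ij.
  by rewrite fE ij.
have prodE (u : 'I_m.+1 -> R) : \prod_i u i ^+ f i = u j ^+ n.
  rewrite (bigD1 j) //= fE eqxx big1 ?mulr1 // => i /negbTE ij.
  by rewrite fE ij expr0.
have := ww' (exist _ f fn); rewrite !ffunE /= !prodE.
move=> /(mulfI (lt0r_neq0 (multinomial_coef_gt0 _ _))) /eqP.
by rewrite eqrXn2 ?ltW // => /eqP.
Qed.

Lemma weightsP (p : multinomial R m n) :
  is_prob (weights p) /\ sval p = multinomial_density (weights p).
Proof. exact: (svalP (cid (svalP p))). Qed.

Lemma multinomial_naturalK : cancel (@natural _ _ _ E) (@of_natural _ _ _ E).
Proof.
move=> p; have [pw pE] := weightsP p; apply: sval_inj => /=; rewrite pE.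
by congr multinomial_density; apply/funext; exact: log_ratiosK.
Qed.

Lemma multinomial_of_naturalK : cancel (@of_natural _ _ _ E) (@natural _ _ _ E).
Proof.
move=> t /=; rewrite -[RHS]softmaxK; congr log_ratios; apply/funext.
have [pw pE] := weightsP (multinomial_softmax t).
by apply: multinomial_density_inj => //; exact: softmax_prob.
Qed.

Lemma pairing_cst (k : Omega m n) (c : R) : pairing k (fun=> c) = n%:R * c.
Proof.
by rewrite /pairing -mulr_suml -natr_sum (eqP (valP k)).
Qed.

Lemma pairingB (k : Omega m n) (a b : 'I_m.+1 -> R) :
  pairing k (fun j => a j - b j) = pairing k a - pairing k b.
Proof. by rewrite /pairing -sumrB; apply: eq_bigr => j _; rewrite mulrBr. Qed.

Lemma ln_multinomial_density t (k : Omega m n) :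
  ln (multinomial_density (softmax t) k) =
  ln (multinomial_coef k) + pairing k (append0 t) - n%:R * log_partition t :> R.
Proof.
rewrite ffunE lnM ?posrE ?multinomial_coef_gt0 //; last first.
  by apply: prodr_gt0 => j _; apply: exprn_gt0; exact: expR_gt0.
under eq_bigr do rewrite /softmax -expRM_natl.
rewrite -expR_sum expRK -addrA; congr (_ + _).
rewrite -(pairing_cst k) -pairingB //.
Qed.

Lemma is_derive_pairing (k : Omega m n) (t v : 'rV[R]_m) :
  is_derive t v (fun x => pairing k (append0 x)) (pairing k (append0 v)).
Proof.
apply: is_derive_sum_seq => j.
exact: (is_deriveZ _ (is_derive_append0 t v j)).
Qed.

(** The score is the multinomial variable attached to a centered function,
    whose second moment is [n] times that of a single trial. *)
Lemma fisher_multinomial (p : E) (v w : 'rV[R]_m) :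
  fisher p v w =
  (n%:R^-1)^-1 * cov (softmax (natural p)) (append0 v) (append0 w).
Proof.
rewrite invrK -softmax_mean_cov; set t := natural p.
pose S v (k : Omega m n) : R := pairing k (centered t v).
have sE i k : score p i k = S (delta_mx 0 i) k.
  rewrite /score /S (_ : (fun t => _) = (cst (ln (multinomial_coef k)) +
      (fun t => pairing k (append0 t))) - n%:R *: log_partition); last first.
    by apply/funext => x /=; rewrite ln_multinomial_density.
  have hp := is_derive_pairing k t (delta_mx 0 i).
  have hl := is_deriveZ n%:R (is_derive_log_partition t (delta_mx 0 i)).
  have [_ ->] := is_deriveB (is_deriveD
    (is_derive_cst (ln (multinomial_coef k)) t (delta_mx 0 i)) hp) hl.
  by rewrite add0r pairingB pairing_cst.
rewrite (fisher_score sE); last first.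
  move=> u k; rewrite /S /pairing.
  under eq_bigr do rewrite centered_sum mulr_sumr.
  rewrite exchange_big /=; apply: eq_bigr => i _.
  by rewrite mulr_sumr; apply: eq_bigr => j _; rewrite mulrCA.
have dE : density p = multinomial_density (softmax t).
  by rewrite -{1}(multinomial_naturalK p).
rewrite dE multinomial_moment2 //; first exact: (softmax_prob t).2.
exact: softmax_mean_centered.
Qed.

End MultinomialGeometry.

(** * The Veronese embedding as a lift *)

Section Lift.
Context {R : realType} {m n N : nat}.
Hypothesis n_gt0 : (0 < n)%N.
Variable e : ordering (Omega m n) N.+1.
Local Notation E := (multinomial_family R m n).
Local Notation E' := (@positive_prob_family R (Omega m n) N e).

Lemma veronese_smooth :
  smooth (veronese e : @projective_manifold R m -> @projective_manifold R N).
Proof.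
move=> W; pose h x := homogenize (pivot W) 1 x : 'rV[R[i]]_m.+1.
apply: (@smooth_at_line _ _ _ _ _ _ (fun x => veronese_coord e (h x))).
- by congr veronese; apply: line_affineK; exact: rep_pivot.
- by move=> x; apply: veronese_coord_neq0; exact: homogenize1_neq0.
- by move=> x; apply: veronese_line; exact: homogenize1_neq0.
move=> k.
have ez : celementary setT (fun x =>
    (Num.sqrt (multinomial_coef (nth_elt e k)))%:C%C *
    \prod_j h x 0 j ^+ val (nth_elt e k) j).
  apply: celementaryM; first exact: celementary_cst.
  apply: celementary_prod => j; apply: celementaryX.
  exact: celementary_homogenize.
by have [h1 h2] := ez; split; [apply: elementary_ext h1|apply: elementary_ext h2]
  => x _; rewrite mxE.
Qed.

(** Logarithms of the multinomial probabilities, without the term - n psi that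
    is common to all multi-indices and cancels in log-ratios. They are affine
    in the natural parameters, so the inclusion is affine too. *)
Definition affine_inclusion (t : 'rV[R]_m) (i : 'I_N.+1) : R :=
  ln (multinomial_coef (nth_elt e i)) + pairing (nth_elt e i) (append0 t).

Lemma natural_inclusion (t : 'rV[R]_m) :
  natural (inclusion (of_natural E t) : E') =
  \row_i (affine_inclusion t (lift ord_max i) - affine_inclusion t ord_max).
Proof.
apply/rowP => i; rewrite !mxE /=.
have d0 k : 0 < multinomial_density (softmax t) k :> R.
  exact: (multinomial_is_prob (multinomial_softmax t)).1.
rewrite ln_div ?posrE // !ln_multinomial_density /affine_inclusion.
ring.
Qed.

Lemma pairingP (h : R) (t t' : 'rV[R]_m) (k : Omega m n) :
  pairing k (append0 (h *: t + t')) =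
  h * pairing k (append0 t) + pairing k (append0 t').
Proof.
rewrite /pairing mulr_sumr -big_split /=; apply: eq_bigr => j _.
by rewrite append0D append0Z mulrDr mulrCA.
Qed.

Lemma inclusion_smooth :
  smooth (inclusion : family_manifold E -> family_manifold E').
Proof.
move=> p; exists setT; split=> //; first exact: openT.
apply: elementary_smooth; first exact: openT.
move=> i.
have ea l : elementary setT (fun t => affine_inclusion t l).
  apply: elementaryD; first exact: elementary_cst.
  apply: elementary_sum => j; apply: elementaryM; first exact: elementary_cst.
  case: (unliftP ord_max j) => [k ->|->].
    by apply: elementary_ext (elementary_coord setT k) => t _;
      rewrite append0_lift.
  by apply: elementary_ext (elementary_cst setT 0) => t _;
    rewrite append0_last.
apply: elementary_ext (elementaryB (ea (lift ord_max i)) (ea ord_max)) => t _.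
have := natural_inclusion t; rewrite /local_rep /= => ->.
by rewrite mxE.
Qed.

Lemma differential_inclusion (p : E) (v : 'rV[R]_m) :
  differential (inclusion : family_manifold E -> family_manifold E') p v =
  \row_i (pairing (nth_elt e (lift ord_max i)) (append0 v) -
          pairing (nth_elt e ord_max) (append0 v)).
Proof.
rewrite /differential (_ : local_rep _ _ = fun t =>
  \row_i (affine_inclusion t (lift ord_max i) - affine_inclusion t ord_max));
  last by apply/funext => t; exact: natural_inclusion.
apply: derive_val; apply: is_derive_affine => h.
by apply/rowP => i; rewrite !mxE /affine_inclusion !pairingP; ring.
Qed.

Lemma sqrt_expR (a : R) : 0 < a -> Num.sqrt a = expR (ln a / 2).
Proof.
move=> a0; have {1}-> : a = expR (ln a / 2) ^+ 2.
  by rewrite -expRM_natl mulrC divfK ?lnK.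
by rewrite sqrtr_sqr ger0_norm // expR_ge0.
Qed.

(** Both sides are lines, spanned by vectors of exponentials. The logarithm of
    the monomial of multi-index k at e^(logc) is the sum of the k_j [logc]_j,
    and the logarithm of the normalizing constant is half of ln of the
    multinomial coefficient: together this is the half of the affine
    expression of the inclusion and of its derivative. The two vectors differ
    by the factor which normalizes the last coordinate to 1. *)
Lemma veronese_lift (u : tangent (family_geometry E)) :
  veronese e (@toric_map _ _ _ E n%:R^-1 u) =
  @toric_map _ _ _ E' 1 (tangent_map
    (inclusion : family_manifold E -> family_manifold E') u).
Proof.
rewrite /toric_map veronese_line; last first.
  by apply: (@entry_neq0 _ _ _ ord_max); exact: zexp_neq0.
set x := row_mx (natural u.1) u.2; set x' := row_mx _ _.
pose L i : R[i] := ((affine_inclusion (natural u.1) i / 2) +i*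
   (pairing (nth_elt e i) (append0 u.2) / 2))%C.
have logcE i : logc x' i = L i - L ord_max.
  have -> : x' = row_mx
      (\row_i (affine_inclusion (natural u.1) (lift ord_max i) -
               affine_inclusion (natural u.1) ord_max))
      (\row_i (pairing (nth_elt e (lift ord_max i)) (append0 u.2) -
               pairing (nth_elt e ord_max) (append0 u.2))).
    congr row_mx; last exact: differential_inclusion.
    by rewrite -natural_inclusion multinomial_naturalK.
  rewrite /logc row_mxKl row_mxKr.
  rewrite (append0_row (affine_inclusion (natural u.1))).
  rewrite (append0_row (fun i => pairing (nth_elt e i) (append0 u.2))).
  by apply: complex_eq; rewrite /= mulrBl.
rewrite -[RHS](@line_scale _ _ (cexp (L ord_max))) ?cexp_neq0 //.
congr line; apply/rowP => i; rewrite !mxE logcE -cexpD addrC subrK.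
under eq_bigr do rewrite mxE -cexpMn.
rewrite -cexp_sum sqrt_expR ?multinomial_coef_gt0 // -cexp_real -cexpD.
congr cexp.
rewrite /L /affine_inclusion /pairing; apply: complex_eq.
  rewrite Re_addc Re_sum /= mulrDl mulr_suml; congr (_ + _).
  by apply: eq_bigr => j _; rewrite Re_mulrn /= row_mxKl mulrA.
rewrite Im_addc Im_sum /= add0r mulr_suml.
by apply: eq_bigr => j _; rewrite Im_mulrn /= row_mxKr mulrA.
Qed.

End Lift.

Theorem proposition11p4 (R : realType) (m n : nat)
    (hm : (1 <= m)%N) (hn : (1 <= n)%N)
    (e : ordering (Omega m n) ('C(m + n, m)).-1.+1) :
  @is_lift R m ('C(m + n, m)).-1
    (family_geometry (multinomial_family R m n))
    (projective_space R m (n%:R)^-1)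
    (family_geometry (positive_prob_family e))
    (projective_space R ('C(m + n, m)).-1 1)
    (veronese e)
    inclusion.
Proof.
have N_gt0 : (0 < 'C(m + n, m).-1)%N.
  case: m hm {e} => // a _; case: n hn => // b _.
  rewrite addSn addnS binS; have := @bin_gt0 (a + b).+1 a.+1.
  have := @bin_gt0 (a + b).+1 a; lia.
split; [exact: veronese_smooth|exact: inclusion_smooth|].
exists (toric_map (n%:R^-1)), (toric_map 1); split.
- apply: toric_map_compatible => //.
  + exact: multinomial_naturalK.
  + exact: multinomial_of_naturalK.
  + exact: fisher_multinomial.
- apply: toric_map_compatible => //.
  + exact: positive_prob_naturalK.
  + exact: positive_prob_of_naturalK.
  + exact: fisher_positive_prob.
exact: veronese_lift.
Qed.
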